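(* Let $p\neq2$ and let $L_{\mathbb{Z}_p}=\mathbb{Z}_p^m$, $m\ge2$, with $Q_L(x)=\sum_{j=1}^{m-1}\varepsilon_jx_j^2+p^\nu\varepsilon_mx_m^2$, where $\varepsilon_j\in\mathbb{Z}_p^\times$ and $\nu\ge1$ (so $L^*/L$ is cyclic of order $p^\nu\neq1$). If $m$ is odd put $\varepsilon=(-1)^{\frac{m-1}{2}}\prod_{j=1}^{m-1}\varepsilon_j$. Then for all $s\in\mathbb{Z}_{\ge0}$, $$\lambda_p(L_{\mathbb{Z}_p};s)=|p^\nu|_p^{\,s+\frac{m-1}{2}}\prod_{i=1}^{\lfloor\frac m2\rfloor-1}(1-p^{-2i-2s})\cdot\begin{cases}1&m\text{ even},\\ 1-\left(\frac{\varepsilon}{p}\right)p^{-\frac{m-1}{2}-s}&m\text{ odd},\end{cases}$$ where $\left(\frac{\cdot}{p}\right)$ is the Legendre symbol.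
   Context: Bilinear form $\langle v,w\rangle=Q(v+w)-Q(v)-Q(w)$; $L^*_{\mathbb{Z}_p}=\{v\in L_{\mathbb{Q}_p}:\langle v,L_{\mathbb{Z}_p}\rangle\subseteq\mathbb{Z}_p\}$; $\mathrm{SO}(L_{\mathbb{Z}_p})$ is the stabilizer of $L_{\mathbb{Z}_p}$ in $\mathrm{SO}(L_{\mathbb{Q}_p})$ and the discriminant kernel $\mathrm{SO}'(L_{\mathbb{Z}_p})$ is the kernel of $\mathrm{SO}(L_{\mathbb{Z}_p})\to\mathrm{Aut}(L^*/L)$. $H$ is the hyperbolic plane $\mathbb{Z}_p^2$ with $Q(x,y)=xy$, $H^s$ the orthogonal sum of $s$ copies. Canonical measure on $\mathrm{SO}(V)$ for a non-degenerate quadratic space $V$ of dimension $r$ over $\mathbb{Q}_p$ (Gram matrix $A$ in a basis $e_i$, Haar measure with $\mathrm{vol}(\mathbb{Z}_p)=1$): the fibre measure $\mu_1/\mu_2$ of $g\mapsto Q\circ g$ over $Q$, with $\mu_1=\prod dx_{ij}$ on $\mathrm{End}(V)$ (coordinates $g(e_j)=\sum x_{ij}e_i$) and $\mu_2=|\det A|^{-(r+1)/2}\prod_{i\le j}dq_{ij}$ on quadratic forms $\sum_{i\le j}q_{ij}y_iy_j$, restricted to $\mathrm{SO}(V)$. $\lambda_p(L_{\mathbb{Z}_p};s):=\mathrm{vol}(\mathrm{SO}'(L_{\mathbb{Z}_p}\perp H^s))/\prod_{i=1}^{s}(1-p^{-2i})$ for $s\in\mathbb{Z}_{\ge0}$.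 *)

(* Defs.v *)
From HB Require Import structures.
From mathcomp Require Import all_boot all_order all_algebra.
From mathcomp Require Import all_classical all_reals all_analysis.
Set Implicit Arguments. Unset Strict Implicit. Unset Printing Implicit Defensive.
Import Order.TTheory GRing.Theory Num.Theory.
Local Open Scope ring_scope.
Local Open Scope classical_set_scope.

(* p-adic integers Z_p, realised as digit sequences x = sum_i x_i p^i. *)
Definition padicInt (p : nat) := nat -> 'I_p.

Definition trunc (p : nat) (x : padicInt p) (k : nat) : int :=
  ((\sum_(i < k) (x i : nat) * p ^ i)%N)%:Z.

Definition cong (p k : nat) (a b : int) : bool :=
  (a == b %[mod ((p ^ k)%N)%:Z])%Z.

(* A p-adic integer is given by the compatible family of its residues
   c k (mod p^k).  Its p-adic absolute value: inf { p^-n | p^n divides it }. *)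
Definition pabs (R : realType) (p : nat) (c : nat -> int) : R :=
  inf [set (p%:R ^- n : R) | n in [set n : nat | cong p n (c n) 0]].

Definition legendre (p : nat) (a : int) : int :=
  if (((p%:Z) %| a)%Z) then 0
  else if [exists x : 'I_p, cong p 1 ((x : nat)%:Z ^+ 2) a] then 1 else -1.

(* Haar measure on Z_p^I (I finite), vol(Z_p) = 1, as the Caratheodory
   outer measure built from cylinder sets (balls). *)
Definition cyl (p : nat) (I : finType) (a : I -> padicInt p) (k : nat) : set (I -> padicInt p) :=
  [set x | forall i t, (t < k)%N -> x i t = a i t].

Definition haar (R : realType) (p : nat) (I : finType) (S : set (I -> padicInt p)) : \bar R :=
  ereal_inf [set (\sum_(0 <= n <oo) ((p%:R ^- ((c n).2 * #|I|)%N : R))%:E)%E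
            | c in [set c : nat -> (I -> padicInt p) * nat |
                     S `<=` \bigcup_n cyl (c n).1 (c n).2]].

Definition popen (p : nat) (I : finType) (U : set (I -> padicInt p)) : Prop :=
  forall x, U x -> exists k, cyl x k `<=` U.

(* The lattice M = L_{Z_p} (+) H^s = Z_p^r, r = m + 2s, with basis e_0..e_{r-1}:
   Q(x) = sum_{j < m-1} eps_j x_j^2 + p^nu eps_{m-1} x_{m-1}^2
          + sum_{t < s} x_{m+2t} x_{m+2t+1}.
   qcoef p m nu eps s k i j = residue mod p^k of the coefficient q_ij (i <= j)
   of the monomial x_i x_j in Q. *)
Definition qcoef (p m nu : nat) (eps : nat -> padicInt p) (s k : nat) (i j : 'I_(m + 2 * s)) : int :=
  if i == j :> nat then
    (if (i < m.-1)%N then trunc (eps i) k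
     else if i == m.-1 :> nat then ((p ^ nu)%N)%:Z * trunc (eps m.-1) k
     else 0)
  else if [&& (i < j)%N, (m <= i)%N, ~~ odd (i - m) & (j == i.+1 :> nat)] then 1
  else 0.

Arguments qcoef : clear implicits.

Section Forms.
Variables (p m nu : nat) (eps : nat -> padicInt p) (s : nat).
Local Notation r := (m + 2 * s)%N.

Definition Qval (k : nat) (v : 'I_r -> int) : int :=
  \sum_(i < r) \sum_(j < r | (i <= j)%N) qcoef p m nu eps s k i j * v i * v j.

Definition Bval (k : nat) (v w : 'I_r -> int) : int :=
  Qval k (fun i => v i + w i) - Qval k v - Qval k w.

Definition basisv (i : 'I_r) : 'I_r -> int := fun j => (i == j)%:R.
Definition gram (k : nat) : 'M[int]_r := \matrix_(i, j) Bval k (basisv i) (basisv j).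

(* End(M_{Z_p}) = Z_p^{r x r}; g e_j = sum_i g(i,j) e_i *)
Definition Mat := ('I_r * 'I_r)%type.
Definition col_tr (g : Mat -> padicInt p) (k : nat) (j : 'I_r) : 'I_r -> int :=
  fun i => trunc (g (i, j)) k.
Definition mat_tr (g : Mat -> padicInt p) (k : nat) : 'M[int]_r :=
  \matrix_(i, j) trunc (g (i, j)) k.

(* the coefficients of Q o g are congruent to those of Q modulo p^k,
   i.e. Q o g lies in the box neighbourhood B_k(Q) *)
Definition near_fibre (k : nat) (g : Mat -> padicInt p) : Prop :=
  forall j l : 'I_r, (j <= l)%N ->
    cong p k (if j == l then Qval k (col_tr g k j)
              else Bval k (col_tr g k j) (col_tr g k l))
             (qcoef p m nu eps s k j l).

Definition isometry (g : Mat -> padicInt p) : Prop := forall k, near_fibre k g.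

Definition det_one (g : Mat -> padicInt p) : Prop :=
  forall k, cong p k (\det (mat_tr g k)) 1.

(* g acts trivially on M^*/M: for every v = p^-N w in M^* (i.e. <w,M> in p^N Z_p),
   (g - 1) v lies in M, i.e. (g - 1) w in p^N M. *)
Definition disc_trivial (g : Mat -> padicInt p) : Prop :=
  forall (N : nat) (w : 'I_r -> padicInt p),
    (forall i, cong p N (Bval N (fun j => trunc (w j) N) (basisv i)) 0) ->
    forall i, cong p N (\sum_(j < r) trunc (g (i, j)) N * trunc (w j) N - trunc (w i) N) 0.

Definition SOprime : set (Mat -> padicInt p) :=
  [set g | isometry g /\ det_one g /\ disc_trivial g].

Definition QIdx := {jl : 'I_r * 'I_r | (jl.1 <= jl.2)%N}.

Definition Qbox (k : nat) : set (QIdx -> padicInt p) :=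
  [set q | forall jl : QIdx, cong p k (trunc (q jl) k)
                                 (qcoef p m nu eps s k (val jl).1 (val jl).2)].

Variable R : realType.

Definition mu2_box (k : nat) : R :=
  (pabs R p (fun n => \det (gram n))) `^ (- ((r.+1)%:R / 2)) * fine (haar R (Qbox k)).

(* fibre (Leray) measure mu_1/mu_2 of a subset S of the fibre {g | Q o g = Q}:
   the infimum, over open U in End(M_{Z_p}) containing S, of
   limsup_k mu_1(U /\ g^{-1}(B_k(Q))) / mu_2(B_k(Q)). *)
Definition fibre_vol (S : set (Mat -> padicInt p)) : \bar R :=
  ereal_inf [set limn_esup (fun k => (fine (haar R (U `&` near_fibre k)) / mu2_box k)%:E)
            | U in [set U : set (Mat -> padicInt p) | popen U /\ S `<=` U]].

End Forms.

Arguments SOprime : clear implicits.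
Arguments fibre_vol : clear implicits.

Definition lambda_p (R : realType) (p m nu : nat) (eps : nat -> padicInt p) (s : nat) : \bar R :=
  (fibre_vol p m nu eps s R (SOprime p m nu eps s)
   * ((\prod_(1 <= i < s.+1) (1 - p%:R ^- (2 * i)) : R)^-1)%:E)%E.
Arguments lambda_p : clear implicits.

(* Main.v *)
Require Import Defs.
From HB Require Import structures.
From mathcomp Require Import all_boot all_order all_fingroup all_algebra.
From mathcomp Require Import ring zify.
Set Implicit Arguments. Unset Strict Implicit. Unset Printing Implicit Defensive.
Import Order.TTheory GRing.Theory Num.Theory.
Local Open Scope ring_scope.

(** Write r = m + 2s and n = r - 1, and split Z_p^r into the line spanned by
    e_(m-1), of length p^nu eps_(m-1), and its unimodular complement S.  Inside
    the isometries, SO' is cut out by the two conditions det g = 1 mod p and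
    g(m-1, m-1) = 1 mod p.  These define a clopen set whose intersections with
    the neighbourhoods "Q o g = Q mod p^k" decrease to SO', so by compactness
    the volume is the limit of their volumes, and these are counts in
    M_r(Z/p^k).  In block form (d, b; c, M), with the images of the basis vectors
    as rows, c is free, M S M^T = S - p^nu (2 eps) c c^T, b is determined by M, c
    and d, and d is a square root of a unit = 1 mod p up to the p^nu-torsion.
    The number of M does not depend on c, because every symmetric T = S mod p is
    C S C^T with C = 1 mod p; averaging over T expresses it by the order of
    SO(S mod p).  That order comes from orbit counting: after diagonalising, the
    orthogonal group is transitive on the vectors of given nonzero norm, whose
    number is an iterated sum of the quadratic character. *)

(** * The quadratic character and diagonal forms over a finite field *)

(** Why two conditions mod p suffice: M^*/M is generated by e_(m-1) / p^nu, so triviality on it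
    means g e_(m-1) = e_(m-1) mod p^nu M, that is d = 1 and b = 0 mod p^nu. The block equations
    already give b divisible by p^nu and d^2 = 1 mod p^nu, once k is at least 2 nu; as p is odd,
    only the sign of d mod p is left to prescribe. The same applies to det g, whose square is 1.

    The obstacle is that the form is degenerate mod p: a solution mod p^k need not lift to an
    isometry, because the equation for d holds only up to p^nu-torsion. So nothing is lifted;
    solutions mod p^k are counted, and after normalisation the count is the same for all k > nu. The
    torsion gives a factor p^nu = |p^nu|^-1 and the normalisation of mu_2 a factor |p^nu|^((r+1)/2),
    whence the exponent (m+2s+1)/2 - 1 = s + (m-1)/2. The remaining factor is the order of SO(S mod
    p) over p^(dim SO); its first s factors are those divided out in [lambda_p]. *)

Section QuadraticCharacter.
Variable F : finFieldType.
Hypothesis two_neq0 : 2%:R != 0 :> F.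

Definition chi (x : F) : int :=
  if x == 0 then 0 else if [exists y : F, y ^+ 2 == x] then 1 else -1.

Lemma chi0 : chi 0 = 0.
Proof. by rewrite /chi eqxx. Qed.

Lemma chi_sqr (y : F) : y != 0 -> chi (y ^+ 2) = 1.
Proof.
move=> y0; rewrite /chi sqrf_eq0 (negbTE y0).
by case: existsP => // -[]; exists y.
Qed.

Lemma chi1 : chi 1 = 1.
Proof. by rewrite -(expr1n _ 2) chi_sqr ?oner_eq0. Qed.

Lemma chi_normal (x : F) : x != 0 -> chi x = 1 \/ chi x = -1.
Proof. by rewrite /chi => /negbTE->; case: ifP; [left|right]. Qed.

Lemma chi_eq1 (x : F) : chi x = 1 -> exists2 y, y != 0 & x = y ^+ 2.
Proof.
rewrite /chi; case: eqVneq => // x0.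
case: existsP => // -[y /eqP yx] _; exists y => //.
by apply: contraNneq x0 => y0; rewrite -yx y0 expr0n.
Qed.

Lemma chi_sqrM (y x : F) : y != 0 -> chi (y ^+ 2 * x) = chi x.
Proof.
move=> y0; rewrite /chi mulf_eq0 sqrf_eq0 (negbTE y0) /=.
case: eqP => // _; congr (if _ then _ else _).
apply/existsP/existsP => -[z /eqP zE].
  by exists (y^-1 * z); rewrite exprMn zE mulrA -exprMn mulVf // expr1n mul1r.
by exists (y * z); rewrite exprMn zE.
Qed.

Lemma card_sqrt (x : F) : (#|[pred y : F | y ^+ 2 == x]|)%:Z = 1 + chi x.
Proof.
rewrite /chi; case: eqVneq => [->|x0].
  rewrite (eq_card (B := pred1 0)) ?card1 ?addr0 // => y.
  by rewrite !inE sqrf_eq0.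
case: existsP => [[y /eqP yx]|nex].
  rewrite (eq_card (B := pred2 y (- y))) ?card2.
    suff -> : (y != - y) by [].
    rewrite -subr_eq0 opprK -mulr2n -mulr_natr mulf_eq0 negb_or two_neq0 andbT.
    by apply: contraNneq x0 => y0; rewrite -yx y0 expr0n.
  by move=> z; rewrite !inE -yx eqf_sqr.
rewrite eq_card0 // => y; rewrite !inE.
by apply/negP => yx; apply: nex; exists y.
Qed.

Lemma sum_sqr (G : F -> int) : \sum_y G (y ^+ 2) = \sum_x (1 + chi x) * G x.
Proof.
rewrite (partition_big (fun y : F => y ^+ 2) predT) //=.
apply: eq_bigr => x _; rewrite -card_sqrt.
rewrite (eq_bigr (fun=> G x)); last by move=> y /eqP ->.
by rewrite sumr_const -mulr_natl natz; congr (_%:Z * _); apply: eq_card => y.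
Qed.

(** [sum_sqr] at the constant 1: the squaring map has #|F| points in its source, and its fibres have
    1 + chi x points. *)
Lemma sum_chi : \sum_(x : F) chi x = 0.
Proof.
have := sum_sqr (fun=> 1).
under [in RHS]eq_bigr do rewrite mulr1.
by rewrite big_split /= => /eqP; rewrite -subr_eq0 opprD addNKr oppr_eq0 => /eqP.
Qed.

(** Only two nonsquares x, y need an argument, and it avoids the cyclicity of the unit group. The
    terms - chi (x * z) - chi z are nonnegative (zero when z is a square) and sum to 0 by [sum_chi],
    so each vanishes; z = y gives the claim. *)
Lemma chiM (x y : F) : chi (x * y) = chi x * chi y.
Proof.
have [->|x0] := eqVneq x 0; first by rewrite mul0r chi0 mul0r.
have [->|y0] := eqVneq y 0; first by rewrite mulr0 chi0 mulr0.
have [/chi_eq1[z z0 ->]|cx] := chi_normal x0.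
  by rewrite chi_sqrM // chi_sqr // mul1r.
have [/chi_eq1[z z0 ->]|cy] := chi_normal y0.
  by rewrite mulrC chi_sqrM // chi_sqr // mulr1.
rewrite cx cy mulrNN mulr1.
have /eqP : \sum_z (- chi (x * z) - chi z) = 0.
  have sumM : \sum_z chi (x * z) = 0.
    by rewrite -[RHS]sum_chi [RHS](reindex_inj (mulfI x0)).
  by rewrite big_split /= !sumrN sumM sum_chi subr0.
have ge0 z : 0 <= - chi (x * z) - chi z.
  have [->|z0] := eqVneq z 0; first by rewrite mulr0 chi0.
  have [cz|cz] := chi_normal z0.
    have [u u0 ->] := chi_eq1 cz.
    by rewrite mulrC chi_sqrM // cx chi_sqr.
  have /chi_normal : x * z != 0 by rewrite mulf_neq0.
  by rewrite cz => -[]->.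
rewrite psumr_eq0 => [/allP/(_ y)|z _]; last exact: ge0.
rewrite mem_index_enum => /(_ isT) /=.
by rewrite cy subr_eq0 eqr_opp => /eqP.
Qed.

(** Substituting z = x^2 with weight 1 + chi z leaves, besides a vanishing linear sum, the sum of
    chi (z * (t - a * z)). *)
Lemma sum_chi_quadratic (a t : F) : a != 0 ->
  \sum_x chi (t - a * x ^+ 2) = chi (- a) * ((#|F|)%:Z * (t == 0)%:R - 1).
Proof.
move=> a0; have na0 : - a != 0 by rewrite oppr_eq0.
rewrite (sum_sqr (fun z => chi (t - a * z))).
have sum0 : \sum_z chi (t - a * z) = 0.
  have inj : injective (fun z => t - a * z) by move=> y z /addrI/oppr_inj/(mulfI a0).
  by rewrite -[RHS]sum_chi [RHS](reindex_inj inj).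
rewrite (eq_bigr (fun z => chi (t - a * z) + chi z * chi (t - a * z))); last first.
  by move=> z _; rewrite mulrDl mul1r.
rewrite big_split /= sum0 add0r.
rewrite (bigD1 0) //= chi0 mul0r add0r.
(* For z != 0, z (t - a z) = z^2 (- a) (1 - t / (a z)), and the square drops out. *)
rewrite (eq_bigr (fun z => chi (- a) * chi (1 - t / a / z))); last first.
  move=> z z0; rewrite -!chiM -(@chi_sqrM z^-1) ?invr_eq0 //; congr chi.
  by field; rewrite a0 z0.
rewrite -big_distrr /=; congr (_ * _).
have [->|t0] := eqVneq t 0.
  rewrite mulr1 (eq_bigr (fun=> 1)); last by move=> z z0; rewrite !mul0r subr0 chi1.
  rewrite sumr_const (eq_card (B := predC1 0)) // cardC1 natz.
  by rewrite predn_int // (cardD1 0).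
rewrite mulr0 sub0r; apply/eqP; rewrite -subr_eq0 opprK; apply/eqP.
rewrite -[RHS]sum_chi [RHS](bigD1 1) //= chi1 [LHS]addrC; congr (1 + _).
(* For t != 0 this map is a bijection from the nonzero z onto the elements other than 1, so the sum
   is the full character sum 0 minus chi 1. *)
rewrite [RHS](@reindex _ _ _ _ _ (fun z => 1 - t / a / z)) /=; last first.
  exists (fun z => t / a / (1 - z)) => z.
    by rewrite inE => z1; rewrite subKr invf_div mulrCA mulfV ?mulr1 // mulf_neq0 ?invr_eq0.
  rewrite inE => z1; rewrite invf_div mulrCA mulfV ?mulr1 ?subKr // mulf_neq0 ?invr_eq0 //.
apply: eq_bigl => z.
by rewrite -[in RHS]subr_eq0 addrAC subrr sub0r oppr_eq0 !mulf_eq0 !invr_eq0 (negbTE t0) (negbTE a0).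
Qed.

End QuadraticCharacter.

(** * Representation numbers of diagonal quadratic forms *)

Section DiagonalForms.
Variables (F : finFieldType) (R : numFieldType).
Hypothesis two_neq0 : 2%:R != 0 :> F.
Local Notation q := (#|F|%:R : R).
Local Notation chiR x := ((chi x)%:~R : R).

Definition diag_form n (d v : 'rV[F]_n) : F := \sum_i d 0 i * v 0 i ^+ 2.

Definition diag_reps n (d : 'rV[F]_n) (t : F) : nat :=
  #|[pred v : 'rV[F]_n | diag_form d v == t]|.

Definition disc_sign n (delta : F) : R := chiR ((-1) ^+ n./2 * delta).

(** The number of solutions of a diagonal form of determinant delta equal to t. In the even case
    powers are divided by q instead of lowering the exponent, so that n = 0 gives the correct value
    1 or 0 according to t = 0, the base of the induction. *)
Definition reps_val n (delta t : F) : R :=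
  if odd n then q ^+ n.-1 + q ^+ n./2 * disc_sign n (delta * t)
  else q ^+ n / q + disc_sign n delta * (q ^+ n./2 / q) * (q * (t == 0)%:R - 1).

Lemma q_neq0 : q != 0.
Proof. by rewrite pnatr_eq0 (cardD1 0). Qed.

Lemma diag_form_row n (d0 : F) (d : 'rV[F]_n) (a : F) (v : 'rV[F]_n) :
  diag_form (row_mx d0%:M d : 'rV_(1 + n)) (row_mx a%:M v : 'rV_(1 + n)) =
  d0 * a ^+ 2 + diag_form d v.
Proof.
rewrite /diag_form big_split_ord /= big_ord1 !row_mxEl !mxE eqxx !mulr1n.
by congr (_ + _); apply: eq_bigr => i _; rewrite !row_mxEr.
Qed.

Lemma diag_reps_row n (d0 : F) (d : 'rV[F]_n) (t : F) :
  (diag_reps (row_mx d0%:M d : 'rV_(1 + n)) t =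
   \sum_a diag_reps d (t - d0 * a ^+ 2)%R)%N.
Proof.
pose h (av : F * 'rV[F]_n) : 'rV_(1 + n) := row_mx av.1%:M av.2.
rewrite /diag_reps -sum1_card (reindex h) /=; last first.
  exists (fun w => (lsubmx w 0 0, rsubmx w)) => [[a v]|w] _.
    by rewrite /h row_mxKl row_mxKr !mxE eqxx mulr1n.
  by rewrite /h /= -mx11_scalar hsubmxK.
under eq_bigr do rewrite -[1%N]/(1 * 1)%N.
rewrite (eq_bigl (fun av : F * 'rV[F]_n => predT av.1 && (diag_form d av.2 == t - d0 * av.1 ^+ 2))); last first.
  by case=> a v; rewrite inE /h diag_form_row /= [RHS]eq_sym subr_eq addrC eq_sym.
rewrite -(pair_big_dep predT (fun a v => diag_form d v == t - d0 * a ^+ 2) (fun _ _ => (1 * 1)%N)) /=.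
by apply: eq_bigr => a _; rewrite sum1_card; apply: eq_card => v; rewrite !inE.
Qed.

Lemma prod_row_mx n (d0 : F) (d : 'rV[F]_n) :
  \prod_i (row_mx d0%:M d : 'rV_(1 + n)) 0 i = d0 * \prod_i d 0 i.
Proof.
rewrite big_split_ord /= big_ord1 row_mxEl mxE eqxx mulr1n.
by congr (_ * _); apply: eq_bigr => i _; rewrite row_mxEr.
Qed.

Lemma disc_sign_sqr n (y delta : F) : y != 0 ->
  disc_sign n (y ^+ 2 * delta) = disc_sign n delta.
Proof. by move=> y0; rewrite /disc_sign mulrCA chi_sqrM. Qed.

(** Induction on n, summing over the first coordinate a with t replaced by t - d0 a^2. For odd n the
    character term is summed by [sum_chi_quadratic]; for even n the sum counts the a with d0 a^2 =
    t. *)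
Lemma diag_repsE n (d : 'rV[F]_n) (t : F) : (forall i, d 0 i != 0) ->
  (diag_reps d t)%:R = reps_val n (\prod_i d 0 i) t.
Proof.
elim: n d t => [|n IHn] d t dn0.
  rewrite /reps_val /= big_ord0 /disc_sign /= expr0 mulr1 chi1 // !mul1r.
  rewrite mulrBr mulr1 mulKf ?q_neq0 // addrC subrK /diag_reps.
  have [->|t0] := eqVneq t 0.
    rewrite (eq_card (B := predT)); first by rewrite card_mx muln0 expn0.
    by move=> v; rewrite !inE /diag_form big_ord0 eqxx.
  rewrite eq_card0 // => v; rewrite !inE /diag_form big_ord0 eq_sym.
  exact/negbTE.
pose d0 := lsubmx (d : 'rV_(1 + n)) 0 0; pose d' := rsubmx (d : 'rV_(1 + n)).
have dE : d = row_mx d0%:M d' by rewrite /d0 -mx11_scalar hsubmxK.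
have d0n0 : d0 != 0 by rewrite /d0 mxE dn0.
have d'n0 i : d' 0 i != 0 by rewrite /d' mxE dn0.
have prodE : \prod_i d 0 i = d0 * \prod_i d' 0 i.
  by rewrite {1}dE prod_row_mx.
have dl0 : \prod_i d' 0 i != 0 by apply/prodf_neq0 => i _.
rewrite prodE; set delta := \prod_i d' 0 i in dl0 *.
rewrite {1}dE diag_reps_row natr_sum.
under eq_bigr do rewrite IHn // -/delta.
rewrite /reps_val /=; case on: (odd n) => /=.
  rewrite big_split /= sumr_const -big_distrr /=.
  have -> : \sum_i disc_sign n (delta * (t - d0 * i ^+ 2)) =
     disc_sign n.+1 (d0 * delta) * (q * (t == 0)%:R - 1).
    rewrite /disc_sign -rmorph_sum /=.
    under eq_bigr do rewrite mulrA chiM //.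
    rewrite -big_distrr /= sum_chi_quadratic //.
    rewrite mulrA -chiM // uphalf_half on exprS rmorphM rmorphB rmorphM /=.

    congr (chiR _ * _); first by ring.
    by rewrite rmorph1 natz; case: eqP.
  rewrite uphalf_half on /= add1n exprS mulrAC mulfV ?q_neq0 // mul1r.
  rewrite -[X in X + _]mulr_natr.
  have -> : q ^+ n.-1 * q = q ^+ n by rewrite -exprSr prednK // lt0n; case: n on {IHn d d' dE prodE d'n0 delta dl0 dn0 d0 d0n0}.
  by rewrite [q ^+ n./2.+1]exprSr mulfK ?q_neq0 // mulrA [_ * disc_sign _ _]mulrC.
rewrite big_split /= sumr_const -big_distrr /= sumrB -big_distrr /= sumr_const.
have -> : \sum_i (t - d0 * i ^+ 2 == 0)%:R = 1 + chiR (d0 * t).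
  rewrite -natr_sum.
  have -> : (\sum_i ((t - d0 * i ^+ 2)%R == 0%R) = #|[pred y : F | (y ^+ 2 == d0^-1 * t)%R]|)%N.
    rewrite -sum1_card [RHS]big_mkcond; apply: eq_bigr => i _ /=.
    rewrite inE subr_eq0 -(can2_eq (mulVKf d0n0) (mulKf d0n0)) eq_sym.
    by case: eqP.
  rewrite -[d0 * t](_ : d0 ^+ 2 * (d0^-1 * t) = _); last by rewrite expr2 -mulrA mulVKf.
  by rewrite chi_sqrM // -[1 in RHS]/(1%:~R) -rmorphD /= -card_sqrt.
rewrite uphalf_half on add0n.
have -> : disc_sign n.+1 (d0 * delta * t) = disc_sign n delta * chiR (d0 * t).
  rewrite /disc_sign -rmorphM -chiM //= uphalf_half on.
  by congr (chiR _); ring.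
rewrite -[X in X + _]mulr_natr divfK ?q_neq0 //.
field.
exact: q_neq0.
Qed.

End DiagonalForms.

(** * Orders of orthogonal groups over a finite field *)

Section Reflections.
Variables (F : fieldType) (n : nat) (G : 'M[F]_n).
Hypothesis two_neq0 : 2%:R != 0 :> F.
Hypothesis symG : G^T = G.

Definition bform (u v : 'rV[F]_n) : F := (u *m G *m v^T) 0 0.

Lemma bformE u v : u *m G *m v^T = (bform u v)%:M.
Proof. exact: mx11_scalar. Qed.

Lemma bformC u v : bform u v = bform v u.
Proof.
rewrite /bform -[in LHS](trmxK (u *m G *m v^T)) mxE.
by rewrite trmx_mul trmxK trmx_mul symG mulmxA.
Qed.

Lemma bformDl u v w : bform (u + v) w = bform u w + bform v w.
Proof. by rewrite /bform !mulmxDl mxE. Qed.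

Lemma bformNl u v : bform (- u) v = - bform u v.
Proof. by rewrite /bform !mulNmx mxE. Qed.

Lemma bformDr u v w : bform w (u + v) = bform w u + bform w v.
Proof. by rewrite !(bformC w) bformDl. Qed.

Lemma bformNr u v : bform v (- u) = - bform v u.
Proof. by rewrite !(bformC v) bformNl. Qed.

Definition reflection (u : 'rV[F]_n) : 'M[F]_n :=
  1%:M - (2%:R / bform u u) *: (G *m u^T *m u).

Lemma mul_reflection (u x : 'rV[F]_n) :
  x *m reflection u = x - (2%:R / bform u u * bform x u) *: u.
Proof.
by rewrite mulmxBr mulmx1 -scalemxAr !mulmxA bformE mul_scalar_mx scalerA.
Qed.

Lemma reflection_orthogonal (u : 'rV[F]_n) : bform u u != 0 ->
  reflection u *m G *m (reflection u)^T = G.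
Proof.
move=> u0; rewrite /reflection; set a := _ / _; set K := G *m u^T *m u.
have KG : G *m K^T = K *m G by rewrite /K !trmx_mul trmxK symG !mulmxA.
have KGK : K *m G *m K^T = bform u u *: (K *m G).
  rewrite -mulmxA KG {1}/K -!mulmxA [u *m _]mulmxA [u *m _ *m _]mulmxA.
  by rewrite bformE mul_scalar_mx -!scalemxAr.
have -> : (1%:M - a *: K)^T = 1%:M - a *: K^T by rewrite linearB linearZ /= trmx1.
rewrite mulmxBl mul1mx mulmxBr mulmx1.
rewrite -scalemxAr mulmxBl -!scalemxAl KG KGK !scalerA.
have -> : a * bform u u = 2%:R by rewrite /a divfK.
by rewrite scaler_nat mulr2n opprD addNKr scalerN opprK subrK.
Qed.

Definition orthogonal_mx : pred 'M[F]_n := [pred A | A *m G *m A^T == G].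

Lemma orthogonal_mxM A B : orthogonal_mx A -> orthogonal_mx B -> orthogonal_mx (A *m B).
Proof.
move=> /eqP AG /eqP BG; apply/eqP.
by rewrite trmx_mul -!mulmxA [G *m _]mulmxA [B *m _]mulmxA [B *m _]mulmxA BG mulmxA.
Qed.

Lemma orthogonal_mxN A : orthogonal_mx (- A) = orthogonal_mx A.
Proof. by rewrite /orthogonal_mx /= linearN /= !mulNmx mulmxN opprK. Qed.

Lemma orthogonal_mx_det A : \det G != 0 -> orthogonal_mx A -> \det A ^+ 2 = 1.
Proof.
move=> G0 /eqP/(congr1 determinant); rewrite !det_mulmx det_tr => AG.
by apply: (mulfI G0); rewrite mulr1 -[RHS]AG; ring.
Qed.

Lemma orthogonal_mx_unit A : \det G != 0 -> orthogonal_mx A -> A \in unitmx.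
Proof.
move=> G0 /(orthogonal_mx_det G0) A2; rewrite unitmxE unitfE.
by rewrite -sqrf_eq0 A2 oner_neq0.
Qed.

(* Q (v - w) + Q (v + w) = 4 Q v, so one of v - w, v + w defines a reflection. *)
Lemma orthogonal_transitive (v w : 'rV[F]_n) :
  bform v v = bform w w -> bform v v != 0 ->
  exists2 A, orthogonal_mx A & v *m A = w.
Proof.
move=> vw v0.
have four : bform (v - w) (v - w) + bform (v + w) (v + w) = 2%:R * 2%:R * bform v v.
  rewrite !(bformDl, bformDr, bformNl, bformNr) (bformC w v) -vw; ring.
have [d0|d0] := eqVneq (bform (v - w) (v - w)) 0.
  have s0 : bform (v + w) (v + w) != 0.
    by apply: contraNneq v0 => s0; move/eqP: four; rewrite d0 s0 addr0 eq_sym !mulf_eq0 (negbTE two_neq0).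
  (* The reflection in v + w sends v to - w, hence the sign. *)
  exists (- reflection (v + w)); first by rewrite orthogonal_mxN; apply/eqP/reflection_orthogonal.
  rewrite mulmxN mul_reflection.
  suff -> : 2%:R / bform (v + w) (v + w) * bform v (v + w) = 1.
    by rewrite scale1r opprB addrC addKr.
  apply: (mulIf s0); rewrite mul1r mulrAC divfK //.
  by rewrite !(bformDl, bformDr) (bformC w v) -vw; ring.
exists (reflection (v - w)); first by apply/eqP/reflection_orthogonal.
rewrite mul_reflection.
suff -> : 2%:R / bform (v - w) (v - w) * bform v (v - w) = 1.
  by rewrite scale1r opprB addrC subrK.
apply: (mulIf d0); rewrite mul1r mulrAC divfK //.
by rewrite !(bformDl, bformDr, bformNl, bformNr) (bformC w v) -vw; ring.
Qed.

End Reflections.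

(** * Orbit counting for the orthogonal group of a diagonal form *)

Section OrthogonalGroupOrder.
Variables (F : finFieldType) (R : numFieldType).
Hypothesis two_neq0 : 2%:R != 0 :> F.
Local Notation q := (#|F|%:R : R).

Lemma bform_diag n (d v : 'rV[F]_n) : bform (diag_mx d) v v = diag_form d v.
Proof.
rewrite /bform /diag_form mxE; apply: eq_bigr => i _.
by rewrite mul_mx_diag !mxE; ring.
Qed.

(** An isometry fixing the first basis vector preserves its orthogonal complement; this describes
    the stabiliser in the orbit count. *)
Lemma orthogonal_mx_block n (G0 : F) (G : 'M[F]_n) (A : 'M[F]_n) (c : 'cV[F]_n) :
  G0 != 0 ->
  orthogonal_mx (block_mx G0%:M 0 0 G : 'M_(1 + n)) (block_mx 1%:M 0 c A) =
  (c == 0) && orthogonal_mx G A.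
Proof.
move=> G00; rewrite /orthogonal_mx /= tr_block_mx !mulmx_block.
rewrite !(mul1mx, mulmx1, mul0mx, mulmx0, trmx0, trmx1, addr0, add0r).
apply/eqP/andP => [/eq_block_mx[_ cG _ AG]|[/eqP-> /eqP AG]].
  have c0 : c = 0.
    apply/matrixP => i j; move/matrixP/(_ 0 i): cG; rewrite !ord1 mul_scalar_mx !mxE.
    by move/eqP; rewrite mulf_eq0 (negbTE G00) => /eqP.
  by move: AG; rewrite c0 !mul0mx add0r => ->; rewrite eqxx.
by rewrite AG !(mul0mx, trmx0, mulmx0, add0r).
Qed.

(** Orbit and stabiliser for the first basis vector e. Group the isometries A by v = e A, which runs
    over the vectors of norm d0; by transitivity each fibre is a right translate of the stabiliser
    of e, the orthogonal group of d. *)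
Lemma card_orthogonal_row n (d0 : F) (d : 'rV[F]_n) :
  d0 != 0 -> (forall i, d 0 i != 0) ->
  #|orthogonal_mx (diag_mx (row_mx d0%:M d : 'rV_(1 + n)))| =
  (diag_reps (row_mx d0%:M d : 'rV_(1 + n)) d0 * #|orthogonal_mx (diag_mx d)|)%N.
Proof.
move=> d00 dn0; set D := row_mx _ _; set G := diag_mx D.
have symG : G^T = G by rewrite tr_diag_mx.
have GE : G = block_mx d0%:M 0 0 (diag_mx d).
  rewrite /G diag_mx_row; congr block_mx.
  by apply/matrixP => i j; rewrite !ord1 !mxE.
pose e : 'rV[F]_(1 + n) := row_mx 1%:M 0.
have be : bform G e e = d0.
  rewrite bform_diag /D diag_form_row /diag_form big1 ?addr0 ?expr1n ?mulr1 //.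
  by move=> i _; rewrite mxE expr0n mulr0.
pose K := #|orthogonal_mx (diag_mx d)|.
have cardE : #|[pred A | orthogonal_mx G A && (e *m A == e)]| = K.
  rewrite /K -!sum1_card (reindex (fun A : 'M_n => block_mx 1%:M 0 0 A : 'M_(1 + n))) /=; last first.
    exists (fun A : 'M_(1 + n) => drsubmx A) => A; first by rewrite block_mxKdr.
    rewrite !inE -{1 2 4}[A]submxK => /andP[+ /eqP].
    rewrite mul_row_block !mul1mx !mul0mx !addr0 => /[swap] /eq_row_mx[-> ->].
    by rewrite GE orthogonal_mx_block // => /andP[/eqP-> _].
  apply: eq_bigl => A; rewrite !inE GE orthogonal_mx_block // eqxx /=.
  by rewrite mul_row_block !mul1mx !mul0mx !addr0 eqxx andbT.
rewrite -[LHS]sum1_card (partition_big (fun A => e *m A) (fun v => diag_form D v == d0)) /=; last first.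
  move=> A; rewrite inE => /eqP AG; rewrite -bform_diag /bform -/G.
  by rewrite trmx_mul -!mulmxA [A *m _]mulmxA [A *m _ *m _]mulmxA AG mulmxA -/(bform G e e) be.
rewrite /diag_reps -sum1_card big_distrl /=.
apply: eq_big => [v|v /eqP]; first by rewrite inE.
rewrite -bform_diag -/G -be => vG.
have e0 : bform G e e != 0 by rewrite be.
have [R0 RG eR] := orthogonal_transitive two_neq0 symG (esym vG) e0.
have G0 : \det G != 0.
  by rewrite det_diag prod_row_mx mulf_neq0 //; apply/prodf_neq0.
have Ru := orthogonal_mx_unit G0 RG.
rewrite (reindex (mulmx^~ R0)) /=; last first.
  by exists (mulmx^~ (invmx R0)) => A _; rewrite ?mulmxK ?mulmxKV.
rewrite mul1n -[RHS]/K -cardE -sum1_card; apply: eq_bigl => A.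
rewrite !inE mulmxA -eR (can_eq (mulmxK Ru)); congr (_ && _).
apply/idP/idP => [|AG]; last exact: orthogonal_mxM.
move=> ARG; rewrite -[A](mulmxK Ru); apply: orthogonal_mxM => //.
apply/eqP; rewrite -[in LHS](eqP RG) trmx_inv !mulmxA mulVmx // mul1mx.
by rewrite mulmxK // unitmx_tr.
Qed.

(** The order of the special orthogonal group in dimension n divided by q ^ dim, where dim = n (n -
    1) / 2. *)
Definition so_density n (delta : F) : R :=
  \prod_(1 <= i < uphalf n) (1 - q ^- (2 * i)) *
  (if odd n then 1 else 1 - disc_sign R n delta * q ^- n./2).

Lemma card_orthogonal_diag n (d : 'rV[F]_n) : (0 < n)%N -> (forall i, d 0 i != 0) ->
  (#|orthogonal_mx (diag_mx d)|)%:R =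
  2%:R * q ^+ 'C(n, 2) * so_density n (\prod_i d 0 i).
Proof.
have q0 : q != 0 := q_neq0 F R.
have sign2 k (x : F) : x != 0 -> disc_sign R k x ^+ 2 = 1.
  move=> x0; rewrite /disc_sign -rmorphXn /=.
  have xk : (-1) ^+ k./2 * x != 0 by rewrite mulf_neq0 // expf_eq0 oppr_eq0 oner_eq0 andbF.
  by case: (chi_normal xk) => ->; rewrite ?sqrrN expr1n.
have step k (e : 'rV[F]_k.+1) : (forall i, e 0 i != 0) ->
  exists (d0 : F) (e' : 'rV[F]_k), [/\ d0 != 0, forall i, e' 0 i != 0,
    \prod_i e 0 i = d0 * \prod_i e' 0 i &
    (#|orthogonal_mx (diag_mx e)|)%:R =
    reps_val R k.+1 (d0 * \prod_i e' 0 i) d0 * (#|orthogonal_mx (diag_mx e')|)%:R :> R].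
  move=> en0; pose d0 := lsubmx (e : 'rV_(1 + k)) 0 0.
  pose e' := rsubmx (e : 'rV_(1 + k)).
  have eE : e = row_mx d0%:M e' by rewrite /d0 -mx11_scalar hsubmxK.
  have d00 : d0 != 0 by rewrite /d0 mxE en0.
  have e'n0 i : e' 0 i != 0 by rewrite /e' mxE en0.
  have prodE : \prod_i e 0 i = d0 * \prod_i e' 0 i by rewrite {1}eE prod_row_mx.
  exists d0, e'; split=> //; rewrite {1}eE card_orthogonal_row // natrM -eE.
  by rewrite (diag_repsE R two_neq0 _ en0) prodE.
elim: n d => // n IHn d _ /step[d0 [d' [d00 d'n0 -> ->]]].
(* The induction starts in dimension 1, where the group consists of the two signs; [so_density] at 0
   does not enter. *)
have [n0|n0] := posnP n.
  move: d d' d'n0 {IHn}; rewrite n0 => _ d' d'n0.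
  rewrite big_ord0 mulr1 /reps_val /so_density /= big_geq // !mulr1 expr0 mul1r.
  rewrite /disc_sign /= expr0 !mul1r -expr2 chi_sqr // (eq_card (B := predT)).
    by rewrite card_mx muln0 mulr1.
  by move=> A; rewrite !inE; apply/eqP/matrixP; case.
rewrite IHn // binS bin1 exprD; set delta := \prod_i _.
have delta0 : delta != 0 by apply/prodf_neq0.
rewrite /reps_val /so_density /=; case on: (odd n) => /=.
  have kn : uphalf n = n./2.+1 by rewrite uphalf_half on.
  have qn : q ^+ n = q ^+ n./2 * q ^+ n./2 * q.
    by rewrite -{1}[n]odd_double_half on -addnn exprD exprD expr1; ring.
  rewrite kn (negbTE d00) mulr0 exprS qn exprS; set s := disc_sign R _ _.
  have Q0 : q ^+ n./2 != 0 by rewrite expf_neq0.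
  by move: (\prod_(1 <= i < _) _) => P; field; rewrite Q0 q0.
have kn : uphalf n = n./2 by rewrite uphalf_half on.
have k0 : (0 < n./2)%N by rewrite half_gt0; case: n n0 on {IHn d d' d'n0 delta delta0 kn} => [|[]].
have qn : q ^+ n = q ^+ n./2 * q ^+ n./2.
  by rewrite -{1}[n]odd_double_half on -addnn exprD expr0 mul1r exprD.
have -> : disc_sign R n.+1 (d0 * delta * d0) = disc_sign R n delta.
  rewrite mulrAC -expr2 disc_sign_sqr // /disc_sign /= kn //.
rewrite kn big_nat_recr //= mul2n -addnn exprD qn.
have := sign2 n delta delta0; set s := disc_sign _ _ _ => s2.
have Q0 : q ^+ n./2 != 0 by rewrite expf_neq0.
move: (\prod_(1 <= i < _) _) => P.
(* From even n to n + 1 the representation number supplies 1 + s q^(-n/2), the density for n ends in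
   1 - s q^(-n/2), and s^2 = 1 merges them into the new factor of the product. *)
have -> : 1 - (q ^+ n./2 * q ^+ n./2)^-1 = (1 + s / q ^+ n./2) * (1 - s / q ^+ n./2).
  rewrite [RHS](_ : _ = 1 - s ^+ 2 / (q ^+ n./2 * q ^+ n./2)); last by field.
  by rewrite s2 div1r.
by field.
Qed.

End OrthogonalGroupOrder.

(** * Diagonalisation of symmetric matrices away from characteristic 2 *)

Section Diagonalisation.
Variable F : fieldType.
Hypothesis two_neq0 : 2%:R != 0 :> F.

Lemma congr_diag_block n (a : F) (u : 'rV[F]_n) (G : 'M[F]_n) : a != 0 ->
  let P : 'M_(1 + n) := block_mx 1%:M 0 (- a^-1 *: u^T) 1%:M in
  P *m (block_mx a%:M u u^T G : 'M_(1 + n)) *m P^T =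
  block_mx a%:M 0 0 (G - a^-1 *: (u^T *m u)).
Proof.
move=> a0 /=; rewrite tr_block_mx !mulmx_block.
rewrite !(mul1mx, mulmx1, mul0mx, mulmx0, trmx0, trmx1, addr0, add0r).
have cu : a%:M *m (- a^-1 *: u^T)^T = - u.
  by rewrite mul_scalar_mx linearZ /= trmxK scalerA mulrN mulfV // scaleN1r.
have cl : (- a^-1 *: u^T) *m a%:M = - u^T.
  by rewrite mul_mx_scalar scalerA mulrN mulfV // scaleN1r.
rewrite cu cl !addNr mul0mx add0r; congr block_mx.
by rewrite addrC -scalemxAl scaleNr.
Qed.

Lemma bform_delta n (G : 'M[F]_n) i j : bform G (delta_mx 0 i) (delta_mx 0 j) = G i j.
Proof. by rewrite /bform -rowE trmx_delta -colE !mxE. Qed.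

(** Polarisation: if G i j != 0 while both diagonal entries vanish, then e_i + e_j has norm 2 G i
    j. *)
Lemma anisotropic_vector n (G : 'M[F]_n) : G^T = G -> G != 0 ->
  exists v, bform G v v != 0.
Proof.
move=> symG; case: (boolP [exists i, exists j, G i j != 0]); last first.
  rewrite negb_exists => /forallP G0 /eqP[]; apply/matrixP => i j.
  by move/(_ i): G0; rewrite negb_exists => /forallP/(_ j); rewrite negbK mxE => /eqP.
move=> /existsP[i /existsP[j Gij]] _.
have [Gii|] := eqVneq (G i i) 0; last by exists (delta_mx 0 i); rewrite bform_delta.
have [Gjj|] := eqVneq (G j j) 0; last by exists (delta_mx 0 j); rewrite bform_delta.
exists (delta_mx 0 i + delta_mx 0 j); rewrite bformDl !bformDr // !bform_delta.
have -> : G j i = G i j by rewrite -[in LHS]symG mxE.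
by rewrite Gii Gjj add0r addr0 -mulr2n -mulr_natr mulf_neq0.
Qed.

Lemma diagonalise n (G : 'M[F]_n) : G^T = G ->
  exists2 P, P \in unitmx & exists d, P *m G *m P^T = diag_mx d.
Proof.
elim: n G => [|n IHn] G symG.
  by exists 1%:M; [rewrite unitmx1|exists 0; apply/matrixP; case].
have [->|/(anisotropic_vector symG)[v v0]] := eqVneq G 0.
  exists 1%:M; first exact: unitmx1.
  by exists 0; rewrite mulmx0 mul0mx; apply/matrixP => i j; rewrite !mxE mul0rn.
have vn0 : v != 0 by apply: contraNneq v0 => ->; rewrite /bform !mul0mx mxE.
(* [row_ebase v] is an invertible matrix whose first row is proportional to v, so it completes v to
   a basis up to a scalar. *)
pose P1 := row_ebase v; pose G1 : 'M_(1 + n) := P1 *m G *m P1^T.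
have symG1 : G1^T = G1 by rewrite /G1 !trmx_mul trmxK symG mulmxA.
pose a := G1 0 0.
have a0 : a != 0.
  have vE : v = col_ebase v 0 0 *: row 0 P1.
    rewrite -[LHS]mulmx_ebase rank_rV vn0 [col_ebase v]mx11_scalar -mulmxA mul_scalar_mx.
    rewrite -mx11_scalar; congr (_ *: _); rewrite rowE; congr (_ *m _).
    by apply/matrixP => i j; rewrite !mxE !ord1 eqxx /= andbT eq_sym -val_eqE.
  have bZ (c : F) (u : 'rV_n.+1) : bform G (c *: u) (c *: u) = c ^+ 2 * bform G u u.
    by rewrite /bform linearZ /= -scalemxAr -!scalemxAl scalerA [LHS]mxE.
  apply: contraNneq v0 => a00; rewrite vE bZ.
  have -> : bform G (row 0 P1) (row 0 P1) = a.
    by rewrite /a /G1 /bform rowE trmx_mul !mulmxA trmx_delta -colE -!mulmxA -rowE !mxE.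
  by rewrite a00 mulr0.
have G1E : G1 = block_mx a%:M (ursubmx G1) (ursubmx G1)^T (drsubmx G1).
  rewrite -[LHS]submxK; congr block_mx; last by rewrite trmx_ursub symG1.
  have ul (M : 'M[F]_(1 + n)) : ulsubmx M 0 0 = M 0 0.
    by rewrite !mxE; congr (M _ _); apply: val_inj.
  by rewrite [LHS]mx11_scalar ul.
have := congr_diag_block (ursubmx G1) (drsubmx G1) a0; rewrite /= -G1E.
set P2 := block_mx _ _ _ _; set G2 := _ - _ => P2E.
have symG2 : G2^T = G2.
  by rewrite /G2 linearB linearZ /= trmx_mul trmxK trmx_drsub symG1.
have [P3 P3u [d dE]] := IHn G2 symG2.
pose P4 : 'M_(1 + n) := block_mx 1%:M 0 0 P3.
have P4u : P4 \in unitmx by rewrite unitmxE det_lblock det1 mul1r -unitmxE.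
have P2u : P2 \in unitmx by rewrite unitmxE det_lblock !det1 mul1r unitr1.
exists (P4 *m (P2 *m P1)).
  by rewrite !unitmx_mul row_ebase_unit P4u P2u.
exists (row_mx a%:M d : 'rV_(1 + n)); rewrite [RHS](diag_mx_row a%:M d) -dE.
have -> : P4 *m (P2 *m P1) *m G *m (P4 *m (P2 *m P1))^T = P4 *m (P2 *m G1 *m P2^T) *m P4^T.
  by rewrite /G1 !trmx_mul !mulmxA.
rewrite P2E tr_block_mx !mulmx_block.
rewrite !(mul1mx, mulmx1, mul0mx, mulmx0, trmx0, trmx1, addr0, add0r).
suff -> : diag_mx (a%:M : 'rV_1) = a%:M by [].
by apply/matrixP => i j; rewrite !ord1 !mxE.
Qed.

End Diagonalisation.

(** * Orders of special orthogonal groups *)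

Section SpecialOrthogonalGroupOrder.
Variables (F : finFieldType) (R : numFieldType).
Hypothesis two_neq0 : 2%:R != 0 :> F.
Local Notation q := (#|F|%:R : R).

Definition special_orthogonal_mx n (G : 'M[F]_n) : pred 'M[F]_n :=
  [pred A | orthogonal_mx G A && (\det A == 1)].

(** Multiplication by the isometry J = diag(-1, 1, ..., 1) exchanges determinants 1 and -1, which
    differ in F. *)
Lemma card_special_orthogonal_diag n (d : 'rV[F]_n) : (0 < n)%N ->
  (forall i, d 0 i != 0) ->
  (2 * #|special_orthogonal_mx (diag_mx d)| = #|orthogonal_mx (diag_mx d)|)%N.
Proof.
case: n d => // n d _ dn0.
have D0 : \det (diag_mx d) != 0 by rewrite det_diag; apply/prodf_neq0.
pose J : 'M[F]_(1 + n) := block_mx (- 1%:M) 0 0 1%:M.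
have JE : J = diag_mx (row_mx (- 1%:M) (const_mx 1) : 'rV_(1 + n)).
  rewrite diag_mx_row diag_const_mx; suff -> : diag_mx (- 1%:M : 'rV[F]_1) = - 1%:M by [].
  by apply/matrixP => i j; rewrite !ord1 !mxE.
have detJ : \det J = -1 by rewrite det_ublock det1 mulr1 det_mx11 !mxE.
have JJ : J *m J = 1%:M.
  rewrite mulmx_block !(mulmx0, mul0mx, addr0, add0r, mulmx1) mulmxN mulNmx mulmx1 opprK.
  by rewrite -scalar_mx_block.
have JO : orthogonal_mx (diag_mx d) J.
  apply/eqP; rewrite {2}JE tr_diag_mx -JE -mulmxA.
  by rewrite {2}JE diag_mx_comm -JE mulmxA JJ mul1mx.
have detO A : orthogonal_mx (diag_mx d) A -> \det A = 1 \/ \det A = -1.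
  move/(orthogonal_mx_det D0) => /eqP; rewrite sqrf_eq1.
  by case/orP => /eqP; [left|right].
rewrite -(cardID [pred A | \det A == 1] (orthogonal_mx (diag_mx d))) mul2n -addnn.
congr (_ + _)%N.
rewrite -!sum1_card (reindex (mulmx J)) /=; last first.
  by exists (mulmx J) => A _; rewrite mulmxA JJ mul1mx.
apply: eq_bigl => A; rewrite !inE /special_orthogonal_mx /= det_mulmx detJ mulN1r.
have JAO : orthogonal_mx (diag_mx d) (J *m A) = orthogonal_mx (diag_mx d) A.
  apply/idP/idP => [JA|]; last exact: orthogonal_mxM.
  by rewrite -[A]mul1mx -JJ -mulmxA; apply: orthogonal_mxM.
rewrite [X in X && _]JAO andbC -[X in _ = _ && X]/(orthogonal_mx (diag_mx d) A); case: (boolP (orthogonal_mx _ A)) => AO; rewrite ?andbF ?andbT //.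
have n11 : (-1 : F) != 1.
  by rewrite eq_sym -subr_eq0 opprK -(natrD _ 1 1).
case: (detO A AO) => ->; rewrite ?opprK ?eqxx ?(negbTE n11) //.
Qed.

Lemma so_density_sqr n (y delta : F) : y != 0 ->
  so_density R n (y ^+ 2 * delta) = so_density R n delta.
Proof. by move=> y0; rewrite /so_density disc_sign_sqr. Qed.

(** Conjugation by a diagonalising P carries one group to the other and changes the determinant of
    the form by the square of det P, which [so_density] does not see. *)
Lemma card_special_orthogonal n (G : 'M[F]_n) : (0 < n)%N -> G^T = G ->
  \det G != 0 ->
  (#|special_orthogonal_mx G|)%:R = q ^+ 'C(n, 2) * so_density R n (\det G).
Proof.
move=> n0 symG G0; have [P Pu [d PGP]] := diagonalise two_neq0 symG.
have detP : \det P != 0 by rewrite -unitfE -unitmxE.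
have detD : \prod_i d 0 i = \det P ^+ 2 * \det G.
  by rewrite -det_diag -PGP !det_mulmx det_tr; ring.
have dn0 i : d 0 i != 0.
  have : \prod_i d 0 i != 0 by rewrite detD mulf_neq0 // expf_neq0.
  by move/prodf_neq0; apply.
have -> : #|special_orthogonal_mx G| = #|special_orthogonal_mx (diag_mx d)|.
  rewrite -!sum1_card [RHS](reindex (fun A => P *m A *m invmx P)) /=; last first.
    by exists (fun A => invmx P *m A *m P) => A _; rewrite !mulmxA ?mulmxKV ?mulmxK ?mulKmx // ?mulmxV ?mulVmx // !mul1mx ?mulmxKV ?mulmxK.
  apply: eq_bigl => A; rewrite !inE /special_orthogonal_mx /= !det_mulmx det_inv mulrAC mulfV // mul1r.
  congr (_ && _); rewrite /orthogonal_mx /= -PGP ![in RHS]trmx_mul trmx_inv.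
  have -> : P *m A *m invmx P *m (P *m G *m P^T) *m (invmx P^T *m (A^T *m P^T)) = P *m (A *m G *m A^T) *m P^T.
    by rewrite !mulmxA mulmxKV // mulmxK ?unitmx_tr.
  by rewrite (can_eq (mulmxK _)) ?unitmx_tr // (can_eq (mulKmx Pu)).
have t0 : 2%:R != 0 :> R by rewrite pnatr_eq0.
apply: (mulfI t0).
rewrite -natrM (card_special_orthogonal_diag n0 dn0) (card_orthogonal_diag R two_neq0 n0 dn0).
by rewrite detD so_density_sqr // -mulrA.
Qed.

End SpecialOrthogonalGroupOrder.

(** * Isometries over a finite local ring *)

Section UpperIndex.
Variable n : nat.

Definition upper := {ij : 'I_n * 'I_n | (ij.1 <= ij.2)%N}.

Lemma card_upper : #|{: upper}| = 'C(n.+1, 2).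
Proof.
rewrite card_sig -sum1_card.
rewrite (eq_bigl (fun ij : 'I_n * 'I_n => predT ij.1 && (ij.1 <= ij.2)%N)); last by [].
rewrite -(pair_big_dep predT (fun i j : 'I_n => (i <= j)%N) (fun _ _ => 1%N)) /=.
rewrite (exchange_big_dep predT) //= -bin2_sum big_mkord big_ord_recl add0n.
apply: eq_bigr => i _; rewrite lift0 sum1_card -[RHS](card_ord i.+1).
have lt (j : 'I_i.+1) : (j < n)%N by apply: leq_trans (ltn_ord j) _.
have inj : injective (fun j => Ordinal (lt j)) by move=> a b [ab]; apply: val_inj.
rewrite -(card_imset _ inj).
apply: eq_card => j; apply/idP/imsetP => [ji|[a _ ->]].
  by exists (Ordinal (ji : (j < i.+1)%N)) => //; apply: val_inj.
by apply: (ltn_ord a).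
Qed.

(** The unordered pair {i, j}, at which both entries (i, j) and (j, i) of a symmetric matrix are
    read. *)
Definition to_upper (i j : 'I_n) : upper :=
  insubd (Sub (i, i) (leqnn i) : upper) (if (i <= j)%N then (i, j) else (j, i)).

Lemma val_to_upper i j :
  val (to_upper i j) = if (i <= j)%N then (i, j) else (j, i).
Proof. by rewrite insubdK //; case: leqP => // /ltnW. Qed.

Lemma to_upperC i j : to_upper i j = to_upper j i.
Proof.
apply: val_inj; rewrite !val_to_upper; case: ltngtP => // ij.
by have -> : i = j by apply: val_inj.
Qed.

Lemma to_upperK (u : upper) : to_upper (val u).1 (val u).2 = u.
Proof. by apply: val_inj; rewrite val_to_upper (valP u); case: (val u). Qed.

End UpperIndex.

Section LocalRing.
Variables (A : finComUnitRingType) (F : finFieldType) (red : {rmorphism A -> F}).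
Variables (pi : A) (k nu : nat).
Hypothesis two_neq0 : 2%:R != 0 :> F.
Hypothesis red_surj : forall y, exists x, red x = y.
Hypothesis red_unit : forall x, red x != 0 -> x \is a GRing.unit.
Hypothesis red_ker : forall x, red x = 0 -> exists y, x = pi * y.
Hypothesis red_pi : red pi = 0.
Hypothesis pi_nilp : pi ^+ k = 0.
Hypothesis pi_nu : pi ^+ nu != 0.
Hypothesis nu_gt0 : (0 < nu)%N.

Definition ker_card := #|[pred x | red x == 0]|.

Lemma card_red_fibre y : #|[pred x | red x == y]| = ker_card.
Proof.
have [x0 <-] := red_surj y.
rewrite /ker_card -!sum1_card [LHS](reindex_inj (addrI x0)).
apply: eq_bigl => x; rewrite !inE rmorphD -[X in _ == X]addr0.
by rewrite (inj_eq (addrI _)).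
Qed.

Lemma ker_cardM : (ker_card * #|F| = #|A|)%N.
Proof.
rewrite -[RHS]sum1_card (partition_big red predT) //=.
rewrite mulnC -[in LHS]sum_nat_const; apply: eq_bigr => y _.
by rewrite -(card_red_fibre y) -sum1_card; apply: eq_bigl => x; rewrite inE.
Qed.

Lemma card_ffun_lift (I : finType) (g : {ffun I -> F}) :
  #|[pred f : {ffun I -> A} | [forall i, red (f i) == g i]]| = (ker_card ^ #|I|)%N.
Proof.
rewrite -(eq_card (A := family (fun i => [pred x | red x == g i]))).
  rewrite card_family foldrE big_map (eq_bigr (fun=> ker_card)).
    by rewrite big_const_seq count_predT -cardE iter_muln_1.
  by move=> i _; apply: card_red_fibre.
by move=> f; rewrite !inE; apply: eq_forallb => i; rewrite inE.
Qed.

Lemma card_mx_lift m n (N : 'M[F]_(m, n)) :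
  #|[pred M : 'M[A]_(m, n) | map_mx red M == N]| = (ker_card ^ (m * n))%N.
Proof.
rewrite -[in RHS](card_ord m) -[in RHS](card_ord n) -card_prod.
rewrite -(card_ffun_lift [ffun ij => N ij.1 ij.2]) -!sum1_card.
rewrite (reindex (fun f : {ffun 'I_m * 'I_n -> A} => \matrix_(i, j) f (i, j))) /=; last first.
  exists (fun M : 'M_(m, n) => [ffun ij => M ij.1 ij.2]) => M _.
    by apply/ffunP => -[i j]; rewrite ffunE mxE.
  by apply/matrixP => i j; rewrite mxE ffunE.
apply: eq_bigl => f; rewrite !inE; apply/eqP/forallP => [/matrixP fN [i j]|fN].
  by have := fN i j; rewrite !mxE ffunE => ->.
by apply/matrixP => i j; move/eqP: (fN (i, j)); rewrite !mxE ffunE.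
Qed.

Lemma card_mx_lift_pred m n (B : pred 'M[F]_(m, n)) :
  #|[pred M : 'M[A]_(m, n) | B (map_mx red M)]| = (#|B| * ker_card ^ (m * n))%N.
Proof.
rewrite -[LHS]sum1_card (partition_big (fun M : 'M[A]_(m, n) => map_mx red M) B) //=.
rewrite -sum_nat_const; apply: eq_bigr => N BN.
rewrite sum1_card -(card_mx_lift N); apply: eq_card => M.
rewrite !inE; apply/andP/eqP => [[_ /eqP]//|MN].
by split; [move: BN; rewrite -MN|apply/eqP].
Qed.

Lemma card_sym_lift n (S0 : 'M[F]_n) : S0^T = S0 ->
  #|[pred T : 'M[A]_n | (T^T == T) && (map_mx red T == S0)]| =
  (ker_card ^ 'C(n.+1, 2))%N.
Proof.
move=> symS; rewrite -card_upper.
rewrite -(card_ffun_lift [ffun u : upper n => S0 (val u).1 (val u).2]) -!sum1_card.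
pose h (f : {ffun upper n -> A}) : 'M[A]_n := \matrix_(i, j) f (to_upper i j).
rewrite (reindex h) /=; last first.
  exists (fun T : 'M_n => [ffun u : upper n => T (val u).1 (val u).2]) => M.
    by move=> _; apply/ffunP => u; rewrite ffunE mxE to_upperK.
  rewrite inE => /andP[/eqP symM _]; apply/matrixP => i j; rewrite mxE ffunE.
  by rewrite val_to_upper; case: leqP => //= _; rewrite -[in RHS]symM mxE.
apply: eq_bigl => f; rewrite !inE.
have -> : (h f)^T == h f by apply/eqP/matrixP => i j; rewrite !mxE to_upperC.
apply/eqP/forallP => [/matrixP fS u|fS].
  by have := fS (val u).1 (val u).2; rewrite !mxE ffunE to_upperK => ->.
apply/matrixP => i j; rewrite !mxE (eqP (fS _)) ffunE val_to_upper.
by case: leqP => //= _; rewrite -[in RHS]symS mxE.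
Qed.

Lemma two_unit : (2%:R : A) \is a GRing.unit.
Proof. by apply: red_unit; rewrite rmorph_nat. Qed.

Lemma red1_unit x : red x = 1 -> x \is a GRing.unit.
Proof. by move=> x1; apply: red_unit; rewrite x1 oner_neq0. Qed.

(** Counting replaces Hensel's lemma: squaring maps the finite set of elements reducing to 1 into
    itself, and injectively, since there x + y reduces to 2 and is a unit; so it is onto. *)
Lemma sqrt_red1 a : red a = 1 -> exists2 d, red d = 1 & d ^+ 2 = a.
Proof.
move=> a1; pose P := [set x | red x == 1].
have inj : {in P &, injective (fun x => x ^+ 2)}.
  move=> x y; rewrite !inE => /eqP x1 /eqP y1 /eqP; rewrite -subr_eq0 subr_sqr => /eqP xy.
  have u : x + y \is a GRing.unit.
    by apply: red_unit; rewrite rmorphD x1 y1 -(natrD _ 1 1).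
  by apply/eqP; rewrite -subr_eq0 -[_ - _](mulrK u) xy mul0r.
have sub : [set x ^+ 2 | x in P] \subset P.
  by apply/subsetP => z /imsetP[x]; rewrite !inE => /eqP x1 ->; rewrite rmorphXn x1 expr1n.
have : a \in [set x ^+ 2 | x in P].
  have /eqP -> : [set x ^+ 2 | x in P] == P by rewrite eqEcard sub (card_in_imset inj) leqnn.
  by rewrite inE a1.
by case/imsetP => d; rewrite inE => /eqP d1 ->; exists d.
Qed.

Lemma red_unitmx n (M : 'M[A]_n) : \det (map_mx red M) != 0 -> M \in unitmx.
Proof. by rewrite det_map_mx unitmxE => /red_unit. Qed.

Lemma red_mx_ker m n (M : 'M[A]_(m, n)) : map_mx red M = 0 ->
  exists M', M = pi *: M'.
Proof.
move=> /matrixP M0.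
have /fin_all_exists[f fE] : forall ij : 'I_m * 'I_n, exists y, M ij.1 ij.2 = pi * y.
  by move=> [i j]; apply: red_ker; have := M0 i j; rewrite !mxE.
by exists (\matrix_(i, j) f (i, j)); apply/matrixP => i j; rewrite !mxE -(fE (i, j)).
Qed.

(* Newton iteration: if E = T - C S C^T, then C + E C^-T S^-1 / 2 has the error
   - E C^-T S^-1 C^-1 E / 4. *)
Lemma congruent_forms n (S T : 'M[A]_n) : S^T = S -> T^T = T -> S \in unitmx ->
  map_mx red T = map_mx red S ->
  exists2 C, map_mx red C = 1%:M & C *m S *m C^T = T.
Proof.
move=> symS symT Su ST.
suff step j : exists2 C, map_mx red C = 1%:M &
    exists E', T - C *m S *m C^T = pi ^+ j.+1 *: E'.
  have [C C1 [E']] := step k; rewrite exprS pi_nilp mulr0 scale0r => /subr0_eq CT.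
  by exists C.
elim: j => [|j [C C1 [E' EE]]].
  exists 1%:M; first exact: map_mx1.
  rewrite mul1mx trmx1 mulmx1; apply: red_mx_ker.
  by rewrite map_mxB ST subrr.
have Cu : C \in unitmx by apply: red_unitmx; rewrite C1 det1 oner_neq0.
set E := T - _ in EE.
have symE : E^T = E by rewrite /E linearB /= !trmx_mul trmxK symS symT mulmxA.
pose V : 'M[A]_n := invmx C^T *m invmx S.
pose Y' : 'M[A]_n := 2%:R^-1 *: (E' *m V).
have YE : pi ^+ j.+1 *: Y' = 2%:R^-1 *: (E *m V).
  by rewrite /Y' EE scalerA mulrC -scalerA -scalemxAl.
exists (C + pi ^+ j.+1 *: Y').
  rewrite map_mxD map_mxZ C1 rmorphXn /= red_pi exprS mul0r scale0r addr0 //.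
have YC : (pi ^+ j.+1 *: Y') *m S *m C^T = 2%:R^-1 *: E.
  by rewrite YE -!scalemxAl /V !mulmxA mulmxKV // mulmxKV // unitmx_tr.
have CY : C *m S *m (pi ^+ j.+1 *: Y')^T = 2%:R^-1 *: E.
  have -> : 2%:R^-1 *: E = (2%:R^-1 *: E)^T by rewrite linearZ /= symE.
  by rewrite -YC !trmx_mul trmxK symS mulmxA.
(* The new error carries pi ^+ (2 j + 2); only pi ^+ (j + 2) of it is recorded, which suffices
   because pi is nilpotent. *)
exists (- pi ^+ j *: (Y' *m S *m Y'^T)).
have -> : T - (C + pi ^+ j.+1 *: Y') *m S *m (C + pi ^+ j.+1 *: Y')^T =
    E - (2%:R^-1 *: E + 2%:R^-1 *: E) - (pi ^+ j.+1 *: Y') *m S *m (pi ^+ j.+1 *: Y')^T.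
  have TE : T = E + C *m S *m C^T by rewrite /E subrK.
  rewrite {1}TE linearD /= mulmxDl mulmxDr !mulmxDl YC CY.
  by rewrite -[C *m _ *m _ + _ + _]addrA opprD addrA addrK addrA opprD addrA.
rewrite -scalerDl -mulr2n -[_ *+ 2]mulr_natr mulVr ?two_unit // scale1r subrr sub0r.
have -> : (pi ^+ j.+1 *: Y')^T = pi ^+ j.+1 *: Y'^T by rewrite linearZ.
rewrite -scalemxAr -!scalemxAl !scalerA -scaleNr; congr (_ *: _).
by rewrite mulrN -!exprD mulNr addSnnS [in RHS]addnC.
Qed.

(** The determinant is prescribed only after reduction: for T different from S its square is det T /
    det S, and the weaker condition survives multiplication by a C reducing to 1. *)
Definition isometries n (S T : 'M[A]_n) : pred 'M[A]_n :=
  [pred M | (M *m S *m M^T == T) && (red (\det M) == 1)].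

Lemma card_isometries_congr n (S T : 'M[A]_n) : S^T = S -> T^T = T ->
  S \in unitmx -> map_mx red T = map_mx red S ->
  #|isometries S T| = #|isometries S S|.
Proof.
move=> symS symT Su ST; have [C C1 CT] := congruent_forms symS symT Su ST.
have Cu : C \in unitmx by apply: red_unitmx; rewrite C1 det1 oner_neq0.
rewrite -!sum1_card (reindex (mulmx C)) /=; last first.
  by exists (mulmx (invmx C)) => M _; rewrite ?mulKmx ?mulKVmx.
apply: eq_bigl => M; rewrite !inE det_mulmx rmorphM -det_map_mx C1 det1 mul1r.
congr (_ && _); rewrite -CT trmx_mul.
have -> : C *m M *m S *m (M^T *m C^T) = C *m (M *m S *m M^T) *m C^T by rewrite !mulmxA.
by rewrite (can_eq (mulmxK _)) ?unitmx_tr // (can_eq (mulKmx Cu)).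
Qed.

(** Count in two ways the matrices M whose reduction lies in the special orthogonal group: entrywise
    as lifts, and grouped by T = M S M^T, which runs over the symmetric lifts of S mod p with fibres
    of equal size. *)
Lemma card_isometries n (S : 'M[A]_n) : S^T = S -> S \in unitmx ->
  (ker_card ^ 'C(n.+1, 2) * #|isometries S S| =
   #|special_orthogonal_mx (map_mx red S)| * ker_card ^ (n * n))%N.
Proof.
move=> symS Su.
have symS0 : (map_mx red S)^T = map_mx red S by rewrite map_trmx symS.
rewrite -card_mx_lift_pred -(card_sym_lift symS0).
pose L := [pred T : 'M[A]_n | (T^T == T) && (map_mx red T == map_mx red S)].
rewrite -[RHS]sum1_card (partition_big (fun M => M *m S *m M^T) L) /=; last first.
  move=> M; rewrite !inE => /andP[/eqP MO _].
  rewrite !map_mxM -map_trmx MO eqxx andbT.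
  by rewrite !trmx_mul trmxK symS mulmxA.
rewrite -sum_nat_const; apply: eq_bigr => T /andP[/eqP symT /eqP ST].
rewrite sum1_card -(card_isometries_congr symS symT Su ST).
apply: eq_card => M; rewrite !inE -det_map_mx.
transitivity (special_orthogonal_mx (map_mx red S) (map_mx red M) && (M *m S *m M^T == T)) => //.
rewrite /special_orthogonal_mx /orthogonal_mx /= map_trmx -!map_mxM [RHS]andbC.
by case: (M *m S *m M^T =P T) => // ->; rewrite ST eqxx.
Qed.

End LocalRing.

(** * Isometries of a form that degenerates modulo the maximal ideal *)

Section DegenerateForm.
Variables (A : finComUnitRingType) (F : finFieldType) (red : {rmorphism A -> F}).
Variables (pi : A) (k nu : nat).
Hypothesis two_neq0 : 2%:R != 0 :> F.
Hypothesis red_surj : forall y, exists x, red x = y.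
Hypothesis red_unit : forall x, red x != 0 -> x \is a GRing.unit.
Hypothesis red_ker : forall x, red x = 0 -> exists y, x = pi * y.
Hypothesis red_pi : red pi = 0.
Hypothesis pi_nilp : pi ^+ k = 0.
Hypothesis pi_nu : pi ^+ nu != 0.
Hypothesis nu_gt0 : (0 < nu)%N.

Definition card_annihilator := #|[pred x : A | pi ^+ nu * x == 0]|.

Lemma red_pi_nu : red (pi ^+ nu) = 0.
Proof. by rewrite rmorphXn /= red_pi expr0n eqn0Ngt nu_gt0. Qed.

(** Let d0 be the root of d0^2 a = 1 reducing to 1, and d = d0 + x. The condition becomes pi^nu x a
    (2 d0 + x) = 0, where the last two factors are units when x reduces to 0; so x runs over the
    annihilator of pi^nu, which lies in the kernel of [red]. *)
Lemma card_sqrt_mod_annihilator w :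
  #|[pred d | (red d == 1) && (pi ^+ nu * (d ^+ 2 * (1 + pi ^+ nu * w) - 1) == 0)]| =
  card_annihilator.
Proof.
set a := 1 + _.
have a1 : red a = 1 by rewrite /a rmorphD rmorph1 rmorphM red_pi_nu mul0r addr0.
have au : a \is a GRing.unit := red1_unit red_unit a1.
have ai1 : red a^-1 = 1 by rewrite rmorphV // a1 invr1.
have [d0 d1 d2] := sqrt_red1 two_neq0 red_unit ai1.
rewrite /card_annihilator -!sum1_card (reindex_inj (addrI d0)).
apply: eq_bigl => x; rewrite !inE rmorphD d1 -[X in _ == X]addr0 (inj_eq (addrI _)).
have -> : pi ^+ nu * ((d0 + x) ^+ 2 * a - 1) = pi ^+ nu * x * (a * (d0 *+ 2 + x)).
  rewrite -[1 in LHS](mulVr au) -d2; ring.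
have [x0|x0] := eqVneq (red x) 0.
  rewrite /=; have u : a * (d0 *+ 2 + x) \is a GRing.unit.
    apply: red_unit; rewrite rmorphM rmorphD rmorphMn /= a1 d1 x0 addr0 mul1r.
    by rewrite -mulr_natr mul1r.
  by rewrite -[X in _ == X](mul0r (a * (d0 *+ 2 + x))) (inj_eq (mulIr u)).
apply/esym/negbTE; apply: contra pi_nu => /eqP px.
by rewrite -[pi ^+ nu](mulrK (red_unit x0)) px mul0r.
Qed.

Variables (n : nat) (e : A) (S : 'M[A]_n).
Hypothesis e_unit : e \is a GRing.unit.
Hypothesis symS : S^T = S.
Hypothesis S_unit : S \in unitmx.

Definition degenerate_form : 'M[A]_(1 + n) := block_mx (pi ^+ nu * e)%:M 0 0 S.

(** The off-diagonal block equation x d c^T + b S M^T = 0, with x = pi^nu e, has the solution b = -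
    x d times this row. [dual_norm] then collects what b contributes to the equation for d, and
    [defect_form] is the value that c forces on M S M^T. *)
Definition dual_row (c : 'cV[A]_n) (M : 'M[A]_n) : 'rV[A]_n := c^T *m invmx (S *m M^T).

Definition dual_norm c M : A := e * (dual_row c M *m S *m (dual_row c M)^T) 0 0.

Definition defect_form (c : 'cV[A]_n) : 'M[A]_n := S - (pi ^+ nu * e) *: (c *m c^T).

Lemma red_defect_form c : map_mx red (defect_form c) = map_mx red S.
Proof.
by rewrite map_mxB map_mxZ rmorphM red_pi_nu mul0r scale0r subr0.
Qed.

Lemma defect_form_sym c : (defect_form c)^T = defect_form c.
Proof. by rewrite /defect_form linearB linearZ /= trmx_mul trmxK symS. Qed.

(** The lower right block gives M S M^T = [defect_form c], which reduces to S and makes M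
    invertible; the off-diagonal block then yields b; after substitution the upper left block is e
    times the condition on d. Since b reduces to 0 and d to 1, det g and det M have the same
    reduction. *)
Lemma block_isometryP (d : A) (b : 'rV[A]_n) (c : 'cV[A]_n) (M : 'M[A]_n)
    (g := block_mx d%:M b c M : 'M[A]_(1 + n)) :
  [&& g *m degenerate_form *m g^T == degenerate_form, red d == 1 & red (\det g) == 1] =
  [&& isometries red S (defect_form c) M,
      b == - (pi ^+ nu * e * d) *: dual_row c M &
      (red d == 1) && (pi ^+ nu * (d ^+ 2 * (1 + pi ^+ nu * dual_norm c M) - 1) == 0)].
Proof.
have prodE : g *m degenerate_form *m g^T =
    block_mx ((pi ^+ nu * e * d ^+ 2)%:M + b *m S *m b^T)
             ((pi ^+ nu * e * d) *: c^T + b *m S *m M^T)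
             ((pi ^+ nu * e * d) *: c + M *m S *m b^T)
             ((pi ^+ nu * e) *: (c *m c^T) + M *m S *m M^T).
  rewrite /g /degenerate_form tr_block_mx !mulmx_block tr_scalar_mx.
  rewrite !(mul0mx, mulmx0, addr0, add0r); congr block_mx; congr (_ + _).
  - by rewrite -!scalar_mxM; congr (_%:M); ring.
  - by rewrite -scalar_mxM mul_scalar_mx mulrC.
  - by rewrite -mulmxA -scalar_mxM mul_mx_scalar.
  - by rewrite mul_mx_scalar -scalemxAl.
rewrite prodE; set x := pi ^+ nu * e.
have redx : red x = 0 by rewrite rmorphM red_pi_nu mul0r.
have detE : b = - (x * d) *: dual_row c M -> red d = 1 -> red (\det g) = red (\det M).
  move=> bE d1; rewrite -det_map_mx /g map_block_mx.
  have -> : map_mx red b = 0 by rewrite bE map_mxZ rmorphN rmorphM redx mul0r oppr0 scale0r.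
  by rewrite det_lblock map_scalar_mx d1 det1 mul1r det_map_mx.
have bP : M \in unitmx -> (x * d) *: c^T + b *m S *m M^T = 0 <-> b = - (x * d) *: dual_row c M.
  move=> Mu; have SMu : S *m M^T \in unitmx by rewrite unitmx_mul S_unit unitmx_tr.
  rewrite -mulmxA; split=> [/eqP|->].
    rewrite addrC addr_eq0 => /eqP bS.
    by rewrite -[b](mulmxK SMu) bS mulNmx -scalemxAl scaleNr.
  by rewrite -scalemxAl /dual_row mulmxKV // scaleNr subrr.
have normP : b = - (x * d) *: dual_row c M ->
    ((x * d ^+ 2)%:M + b *m S *m b^T == x%:M) =
    (pi ^+ nu * (d ^+ 2 * (1 + pi ^+ nu * dual_norm c M) - 1) == 0).
  move=> bE; set u := dual_row c M in bE *.
  have -> : b *m S *m b^T = ((x * d) ^+ 2 * (u *m S *m u^T) 0 0)%:M.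
    rewrite bE; have -> : (- (x * d) *: u)^T = - (x * d) *: u^T by rewrite linearZ.
    by rewrite -scalemxAr -!scalemxAl scalerA mulrNN [in LHS](mx11_scalar (_ *m _)) scale_scalar_mx.
  have M1 (y z : A) : (y%:M == z%:M :> 'M_1) = (y == z).
    by apply/eqP/eqP => [/matrixP/(_ 0 0)|->//]; rewrite !mxE.
  rewrite -raddfD /= M1 -subr_eq0.
  have -> : x * d ^+ 2 + (x * d) ^+ 2 * (u *m S *m u^T) 0 0 - x =
     e * (pi ^+ nu * (d ^+ 2 * (1 + pi ^+ nu * dual_norm c M) - 1)).
    by rewrite /dual_norm -/u /x; ring.
  by rewrite -[X in _ == X](mulr0 e) (inj_eq (mulrI e_unit)).
apply/and3P/and3P => [[/eqP/eq_block_mx[Eul Eur _ Edr] d1 g1]|[/andP[ME M1] bE /andP[d1 dE]]].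
  have MS : M *m S *m M^T = defect_form c by rewrite /defect_form -[X in X - _]Edr -/x [_ + M *m _ *m _]addrC addrK.
  have Mu : M \in unitmx.
    move/(congr1 determinant): MS; rewrite !det_mulmx det_tr => /(congr1 red).
    rewrite unitmxE => MS; apply: red_unit; apply: contraTneq S_unit => M0.
    move: MS; rewrite rmorphM M0 mulr0 -det_map_mx red_defect_form det_map_mx unitmxE.
    by case: unitrP => // -[y [yS _]] /(congr1 (fun z => red y * z)) /eqP; rewrite mulr0 -rmorphM yS rmorph1 eq_sym oner_eq0.
  have bE := (bP Mu).1 Eur.
  split; first by rewrite /isometries /= MS eqxx -(detE bE (eqP d1)).
    exact/eqP.
  by rewrite d1 -normP // Eul eqxx.
move/eqP: bE => bE; move: ME => /eqP ME.
have Mu : M \in unitmx by rewrite unitmxE; apply: red_unit; rewrite (eqP M1) oner_neq0.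
have Eur := (bP Mu).2 bE.
split=> //; last by rewrite (detE bE (eqP d1)).
move: dE; rewrite -normP // => /eqP ->; rewrite Eur.
have -> : (x * d) *: c + M *m S *m b^T = 0.
  apply: trmx_inj; rewrite trmx0 -Eur linearD linearZ /= !trmx_mul trmxK symS.
  by rewrite mulmxA.
by rewrite ME /defect_form addrC subrK.
Qed.

Lemma card_degenerate_isometries :
  #|[pred g : 'M[A]_(1 + n) | [&& g *m degenerate_form *m g^T == degenerate_form,
      red (g 0 0) == 1 & red (\det g) == 1]]| =
  (#|A| ^ n * #|isometries red S S| * card_annihilator)%N.
Proof.
pose h (x : ('cV[A]_n * 'M[A]_n) * (A * 'rV[A]_n)) : 'M[A]_(1 + n) :=
  block_mx x.2.1%:M x.2.2 x.1.1 x.1.2.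
rewrite -sum1_card (reindex h) /=; last first.
  exists (fun g : 'M_(1 + n) => ((dlsubmx g, drsubmx g), (ulsubmx g 0 0, ursubmx g))).
    by move=> [[c M] [d b]] _; rewrite /h /= block_mxKul block_mxKur block_mxKdl block_mxKdr mxE eqxx mulr1n.
  by move=> g _; rewrite /h /= -mx11_scalar submxK.
pose Pd c M := [pred d | (red d == 1) && (pi ^+ nu * (d ^+ 2 * (1 + pi ^+ nu * dual_norm c M) - 1) == 0)].
rewrite (eq_bigl (fun x : ('cV[A]_n * 'M[A]_n) * (A * 'rV[A]_n) =>
   isometries red S (defect_form x.1.1) x.1.2 &&
   (Pd x.1.1 x.1.2 x.2.1 && (x.2.2 == - (pi ^+ nu * e * x.2.1) *: dual_row x.1.1 x.1.2)))); last first.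
  move=> [[c M] [d b]]; rewrite inE /h /=.
  have -> : block_mx d%:M b c M 0 0 = d.
    have ul (g : 'M[A]_(1 + n)) : ulsubmx g 0 0 = g 0 0.
      by rewrite !mxE; congr (g _ _); apply: val_inj.
    by rewrite -ul block_mxKul mxE eqxx mulr1n.
  rewrite block_isometryP; congr (_ && _); exact: andbC.
rewrite -(pair_big_dep (fun cM => isometries red S (defect_form cM.1) cM.2)
  (fun cM db => Pd cM.1 cM.2 db.1 && (db.2 == - (pi ^+ nu * e * db.1) *: dual_row cM.1 cM.2))
  (fun _ _ => 1%N)) /=.
have inner c M :
    (\sum_(db : A * 'rV[A]_n | Pd c M db.1 &&
      (db.2 == - (pi ^+ nu * e * db.1) *: dual_row c M)) 1 = card_annihilator)%N.
  rewrite -(pair_big_dep (Pd c M)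
    (fun d b => b == - (pi ^+ nu * e * d) *: dual_row c M) (fun _ _ => 1%N)) /=.
  rewrite -(card_sqrt_mod_annihilator (dual_norm c M)) -[RHS]sum1_card.
  by apply: eq_bigr => d _; rewrite big_pred1_eq.
under eq_bigr do rewrite inner.
rewrite -(pair_big_dep predT (fun c M => isometries red S (defect_form c) M)
  (fun _ _ => card_annihilator)) /=.
rewrite (eq_bigr (fun=> #|isometries red S S| * card_annihilator)%N); last first.
  move=> c _; rewrite sum_nat_const; congr (_ * _)%N.
  by apply: (card_isometries_congr two_neq0 red_unit red_ker red_pi pi_nilp);
     rewrite ?defect_form_sym ?red_defect_form.
by rewrite sum_nat_const card_mx muln1 mulnA.
Qed.

Lemma degenerate_isometry_cong (g : 'M[A]_(1 + n)) :
  g *m degenerate_form *m g^T = degenerate_form -> red (g 0 0) = 1 ->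
  red (\det g) = 1 ->
  exists b w, [/\ ursubmx g = pi ^+ nu *: b &
    pi ^+ nu * (g 0 0 ^+ 2 * (1 + pi ^+ nu * w) - 1) = 0].
Proof.
move=> gG g1 gdet.
have ul : ulsubmx g 0 0 = g 0 0 by rewrite !mxE; congr (g _ _); apply: val_inj.
have := block_isometryP (g 0 0) (ursubmx g) (dlsubmx g) (drsubmx g). cbv zeta.
rewrite -ul -mx11_scalar submxK ul gG g1 gdet !eqxx /=.
case/esym/and3P => _ /eqP bE /eqP dE.
exists (- (e * g 0 0) *: dual_row (dlsubmx g) (drsubmx g)).
exists (dual_norm (dlsubmx g) (drsubmx g)); split=> //.
by rewrite bE scalerA; congr (_ *: _); ring.
Qed.

End DegenerateForm.

(** * The rings Z/p^k and their reduction to F_p *)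

Section ResidueRing.
Variables (p k : nat).
Hypotheses (p_pr : prime p) (k_gt0 : (0 < k)%N).
Local Notation Zpk := 'Z_(p ^ k).

Lemma pk_gt1 : (1 < p ^ k)%N.
Proof. by rewrite -(exp1n k) ltn_exp2r // prime_gt1. Qed.
Let q_gt1 := pk_gt1.

Lemma card_Zpk : #|{: Zpk}| = (p ^ k)%N.
Proof. by rewrite card_ord Zp_cast. Qed.

Lemma Zpk_natr_eq (a b : nat) : (a%:R == b%:R :> Zpk) = (a == b %[mod p ^ k])%N.
Proof. by rewrite -val_eqE /= !val_Zp_nat. Qed.

Lemma Zpk_natr_eq0 (a : nat) : (a%:R == 0 :> Zpk) = (p ^ k %| a)%N.
Proof. by rewrite -[0]/(0%:R) Zpk_natr_eq mod0n. Qed.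

Lemma Fp_natr_eq0 (a : nat) : (a%:R == 0 :> 'F_p) = (p %| a)%N.
Proof. by rewrite -[0]/(0%:R) -val_eqE /= !val_Fp_nat // mod0n. Qed.

Definition Zpk_red (x : Zpk) : 'F_p := (x : nat)%:R.

Lemma Zpk_red_nat (a : nat) : Zpk_red a%:R = a%:R.
Proof.
rewrite /Zpk_red val_Zp_nat // [in RHS](divn_eq a (p ^ k)) natrD natrM natrX.
by rewrite pchar_Fp_0 // expr0n eqn0Ngt k_gt0 mulr0 add0r.
Qed.

Lemma Zpk_natP (x : Zpk) : exists a : nat, x = a%:R.
Proof. by exists x; rewrite natr_Zp. Qed.

Lemma Zpk_red_zmod : zmod_morphism Zpk_red.
Proof.
move=> x y; have [a ->] := Zpk_natP x; have [b ->] := Zpk_natP y.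
apply/eqP; rewrite eq_sym subr_eq eq_sym; apply/eqP.
have [c cE] := Zpk_natP (a%:R - b%:R).
by rewrite cE; move/eqP: cE; rewrite subr_eq -natrD => /eqP ->; rewrite !Zpk_red_nat natrD.
Qed.

Lemma Zpk_red_monoid : monoid_morphism Zpk_red.
Proof.
split; first by rewrite -[1]/(1%:R) Zpk_red_nat.
move=> x y; have [a ->] := Zpk_natP x; have [b ->] := Zpk_natP y.
by rewrite -natrM !Zpk_red_nat natrM.
Qed.

HB.instance Definition _ := GRing.isZmodMorphism.Build Zpk 'F_p Zpk_red Zpk_red_zmod.
HB.instance Definition _ := GRing.isMonoidMorphism.Build Zpk 'F_p Zpk_red Zpk_red_monoid.

Definition Zpk_reduction : {rmorphism Zpk -> 'F_p} := Zpk_red.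

Local Notation red := Zpk_reduction.
Local Notation pi := (p%:R : Zpk).

Lemma Zpk_red_natE (a : nat) : red a%:R = a%:R.
Proof. exact: Zpk_red_nat. Qed.

Lemma Zpk_red_surj (y : 'F_p) : exists x, red x = y.
Proof. by exists (y : nat)%:R; rewrite Zpk_red_natE natr_Zp. Qed.

Lemma Zpk_red_unit (x : Zpk) : red x != 0 -> x \is a GRing.unit.
Proof.
have [a ->] := Zpk_natP x; rewrite Zpk_red_natE Fp_natr_eq0 unitZpE //.
by rewrite -prime_coprime // => pa; rewrite coprimeXl.
Qed.

Lemma Zpk_red_ker (x : Zpk) : red x = 0 -> exists y, x = pi * y.
Proof.
have [a ->] := Zpk_natP x; rewrite Zpk_red_natE => /eqP; rewrite Fp_natr_eq0.
by move=> /dvdnP[b ->]; exists b%:R; rewrite natrM mulrC.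
Qed.

Lemma Zpk_red_p : red pi = 0.
Proof. by rewrite Zpk_red_natE pchar_Fp_0. Qed.

Lemma Zpk_pi_nilp : pi ^+ k = 0.
Proof. by apply/eqP; rewrite -natrX Zpk_natr_eq0. Qed.

Lemma Zpk_pi_neq0 nu : (nu < k)%N -> pi ^+ nu != 0.
Proof. by move=> nk; rewrite -natrX Zpk_natr_eq0 dvdn_Pexp2l ?prime_gt1 // -ltnNge. Qed.

Lemma Zpk_annihilator nu (x : Zpk) : (nu <= k)%N -> pi ^+ nu * x = 0 ->
  exists y, x = pi ^+ (k - nu) * y.
Proof.
move=> nk; have [a ->] := Zpk_natP x; rewrite -natrX -natrM => /eqP.
rewrite Zpk_natr_eq0 -{1}(subnK nk) expnD mulnC dvdn_pmul2l ?expn_gt0 ?prime_gt0 //.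
by move=> /dvdnP[b ->]; exists b%:R; rewrite -natrX -natrM mulnC.
Qed.

Lemma Zpk_card_annihilator nu : (nu <= k)%N -> card_annihilator pi nu = (p ^ nu)%N.
Proof.
move=> nk; rewrite /card_annihilator -[RHS]card_ord.
have kE : (p ^ k = p ^ (k - nu) * p ^ nu)%N by rewrite -expnD subnK.
pose f (i : 'I_(p ^ nu)) : Zpk := (p ^ (k - nu) * i)%:R.
have inj : injective f.
  move=> i j /eqP; rewrite Zpk_natr_eq.
  have lt (h : 'I_(p ^ nu)) : (p ^ (k - nu) * h < p ^ k)%N.
    by rewrite kE ltn_pmul2l ?ltn_ord ?expn_gt0 ?prime_gt0.
  rewrite !modn_small ?lt // eqn_pmul2l ?expn_gt0 ?prime_gt0 // => /eqP.
  exact: val_inj.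
rewrite -(card_imset _ inj); apply: eq_card => x; rewrite inE.
apply/eqP/imsetP => [|[i _ ->]]; last first.
  apply/eqP; rewrite /f -natrX -natrM mulnA -expnD subnKC // Zpk_natr_eq0.
  exact: dvdn_mulr.
case/(Zpk_annihilator nk) => y; have [a ->] := Zpk_natP y => ->.
have an : (a %% p ^ nu < p ^ nu)%N by rewrite ltn_mod expn_gt0 prime_gt0.
exists (Ordinal an) => //; apply/eqP; rewrite /f -natrX -natrM Zpk_natr_eq /=.
by rewrite kE !muln_modr modn_mod.
Qed.

Lemma Zpk_ker_card : ker_card red = (p ^ k.-1)%N.
Proof.
have := ker_cardM Zpk_red_surj; rewrite card_Fp // card_Zpk.
by rewrite -[in RHS](prednK k_gt0) expnSr => /eqP; rewrite eqn_pmul2r ?prime_gt0 // => /eqP.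
Qed.

End ResidueRing.

Section ResidueRingCount.
Variables (R : numFieldType) (p k nu n : nat).
Hypotheses (p_pr : prime p) (p_odd : p != 2%N) (k_gt0 : (0 < k)%N).
Hypotheses (nu_gt0 : (0 < nu)%N) (nu_lt : (nu < k)%N) (n_gt0 : (0 < n)%N).
Local Notation Zpk := 'Z_(p ^ k).
Local Notation red := (Zpk_reduction p_pr k_gt0).
Local Notation pi := (p%:R : Zpk).

Lemma Fp_two_neq0 : 2%:R != 0 :> 'F_p.
Proof. by rewrite Fp_natr_eq0 // dvdn_prime2. Qed.

Variables (e : Zpk) (S : 'M[Zpk]_n).
Hypotheses (e_unit : e \is a GRing.unit) (symS : S^T = S) (S_unit : S \in unitmx).

Definition degenerate_isometries : pred 'M[Zpk]_(1 + n) :=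
  [pred g | [&& g *m degenerate_form pi nu e S *m g^T == degenerate_form pi nu e S,
      red (g 0 0) == 1 & red (\det g) == 1]].

Lemma red_det_unit : \det (map_mx red S) != 0.
Proof.
move: S_unit; rewrite unitmxE -unitfE det_map_mx => /(rmorph_unit red).
by rewrite unitfE.
Qed.

(** With r = n + 1, the two powers of p are the mu_1-volume of a residue class mod p^k and the
    volume of a box of forms. Every power of p that depends on k cancels, so the quotient is
    constant in k as soon as nu < k. *)
Lemma degenerate_density :
  (#|degenerate_isometries|)%:R * p%:R ^- (k * (n.+1 * n.+1)) / p%:R ^- (k * 'C(n.+2, 2)) =
  p%:R ^+ nu * so_density R n (\det (map_mx red S)).
Proof.
have p0 : p%:R != 0 :> R by rewrite pnatr_eq0 -lt0n prime_gt0.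
have two := Fp_two_neq0.
have := card_degenerate_isometries two (@Zpk_red_unit p k p_pr k_gt0) (@Zpk_red_ker p k p_pr k_gt0)
  (@Zpk_red_p p k p_pr k_gt0) (@Zpk_pi_nilp p k p_pr k_gt0) (@Zpk_pi_neq0 p k p_pr k_gt0 nu nu_lt) nu_gt0 e_unit symS S_unit.
rewrite -/degenerate_isometries Zpk_card_annihilator ?(ltnW nu_lt) // card_Zpk // => ->.
have := card_isometries two (@Zpk_red_surj p k p_pr k_gt0) (@Zpk_red_unit p k p_pr k_gt0) (@Zpk_red_ker p k p_pr k_gt0)
  (@Zpk_red_p p k p_pr k_gt0) (@Zpk_pi_nilp p k p_pr k_gt0) symS S_unit.
rewrite Zpk_ker_card // => /(congr1 (fun a => a%:R : R)).
have symS0 : (map_mx red S)^T = map_mx red S by rewrite map_trmx symS.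
rewrite !natrM (card_special_orthogonal R two n_gt0 symS0 red_det_unit) card_Fp //.
set N := #|isometries _ _ _|; set D := so_density _ _ _ => ND.
rewrite !natrX in ND *.
have -> : N%:R = D * p%:R ^+ 'C(n, 2) * p%:R ^+ (k.-1 * (n * n)) / p%:R ^+ (k.-1 * 'C(n.+1, 2)).
  apply: (mulfI (_ : p%:R ^+ (k.-1 * 'C(n.+1, 2)) != 0)); first by rewrite expf_neq0.
  rewrite [RHS]mulrC divfK ?expf_neq0 // [D * _]mulrC !exprM ND.
  by rewrite !exprM.
rewrite invrK -!exprM.
have pe a b : a = b -> p%:R ^+ a = p%:R ^+ b :> R by move=> ->.
have E : p%:R ^+ (k * n) * p%:R ^+ 'C(n, 2) * p%:R ^+ (k.-1 * (n * n)) * p%:R ^+ (k * 'C(n.+2, 2)) =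
   p%:R ^+ (k.-1 * 'C(n.+1, 2)) * p%:R ^+ (k * (n.+1 * n.+1)) :> R.
  rewrite -!exprD; apply: pe.
  have c2 m : ('C(m.+1, 2) = m + 'C(m, 2))%N by rewrite binS bin1 addnC.
  (* A form without division, so that the comparison of exponents is polynomial arithmetic. *)
  have c0 m : ('C(m, 2) * 2 + m = m * m)%N.
    by elim: m => // m IHm; rewrite c2; lia.
  have := c0 n; rewrite !c2; case: (k) k_gt0 => // j _ /=; nia.
move: E; set a := _ ^+ (k * n); set b := _ ^+ 'C(n, 2).
set c := _ ^+ (k.-1 * (n * n)); set x := _ ^+ (k.-1 * _); set y := _ ^+ (k * (n.+1 * _)).
set z := _ ^+ (k * _) => E.
have x0 : x != 0 by rewrite expf_neq0.
have y0 : y != 0 by rewrite expf_neq0.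
transitivity (a * b * c * z / (x * y) * (p%:R ^+ nu * D)).
  by field; rewrite x0 y0.
by rewrite E divff ?mul1r // mulf_neq0.
Qed.

(** Cancelling pi^nu in the equation for d leaves an error in pi^(k - nu), still divisible by pi^nu
    because 2 nu <= k. Hence pi^nu divides d^2 - 1, and d + 1 is a unit since it reduces to 2. *)
Lemma degenerate_isometry_mod g : (nu + nu <= k)%N -> degenerate_isometries g ->
  (exists b, ursubmx g = pi ^+ nu *: b) /\ (exists y, g 0 0 - 1 = pi ^+ nu * y).
Proof.
move=> nk /and3P[/eqP gG /eqP g1 /eqP gd].
have [b [w [gb gw]]] := degenerate_isometry_cong (@Zpk_red_unit p k p_pr k_gt0)
   (@Zpk_red_p p k p_pr k_gt0) nu_gt0 e_unit symS S_unit gG g1 gd.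
split; first by exists b.
have nk' : (nu <= k)%N := leq_trans (leq_addr _ _) nk.
have [y yE] := @Zpk_annihilator p k p_pr k_gt0 nu _ nk' gw.
have u : g 0 0 + 1 \is a GRing.unit.
  by apply: (@Zpk_red_unit p k p_pr k_gt0); rewrite rmorphD rmorph1 [X in X + _]g1 -(natrD _ 1 1) Fp_two_neq0.
exists ((pi ^+ (k - nu - nu) * y - g 0 0 ^+ 2 * w) / (g 0 0 + 1)).
apply: (mulIr u); rewrite mulrA mulrVK // mulrBr.
have kE : (k - nu = nu + (k - nu - nu))%N by rewrite subnKC // leq_subRL.
rewrite kE exprD -mulrA in yE; rewrite -yE; ring.
Qed.

End ResidueRingCount.

From mathcomp Require Import all_classical all_reals all_analysis.

(** * The lattice modulo p^k *)

Section Digits.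
Variable p : nat.
Hypothesis p_gt0 : (0 < p)%N.

Definition residue (x : padicInt p) (k : nat) : nat := (\sum_(i < k) x i * p ^ i)%N.

Lemma residueS x k : (residue x k.+1 = residue x k + x k * p ^ k)%N.
Proof. by rewrite /residue big_ord_recr. Qed.

Lemma residue_lt x k : (residue x k < p ^ k)%N.
Proof.
elim: k => [|k IHk]; first by rewrite /residue big_ord0.
rewrite residueS expnSr [(_ ^ _ * p)%N]mulnC.
have xk := ltn_ord (x k); have := leq_mul xk (leqnn (p ^ k)); rewrite mulSn; lia.
Qed.

Lemma residue_mod x j k : (j <= k)%N -> (residue x k %% p ^ j = residue x j)%N.
Proof.
move=> /subnK <-; elim: (k - j)%N => [|i IHi]; first by rewrite modn_small ?residue_lt.
by rewrite addSn residueS -modnDmr expnD mulnA modnMl addn0.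
Qed.

Lemma residue_eq_digits x y k : residue x k = residue y k ->
  forall t, (t < k)%N -> x t = y t.
Proof.
move=> xy t tk; apply: val_inj => /=.
have xyt j : (j <= k)%N -> residue x j = residue y j.
  by move=> jk; rewrite -(residue_mod x jk) xy residue_mod.
have := xyt t.+1 tk; rewrite !residueS (xyt t (ltnW tk)) => /addnI/eqP.
by rewrite eqn_pmul2r ?expn_gt0 ?p_gt0 // => /eqP.
Qed.

Lemma residue_ext x y k : (forall t, (t < k)%N -> x t = y t) ->
  residue x k = residue y k.
Proof. by move=> xy; apply: eq_bigr => i _; rewrite xy. Qed.

Definition digits_of (y : nat) : padicInt p := fun t => Ordinal (ltn_pmod (y %/ p ^ t) p_gt0).

Lemma residue_digits_of y k : residue (digits_of y) k = (y %% p ^ k)%N.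
Proof.
elim: k => [|k IHk]; first by rewrite /residue big_ord0 modn1.
rewrite residueS IHk /=.
have E : y = (y %/ p ^ k %/ p * p ^ k.+1 + (y %/ p ^ k %% p * p ^ k + y %% p ^ k))%N.
  by rewrite addnA expnS mulnA -mulnDl -divn_eq -divn_eq.
rewrite [in RHS]E modnMDl [RHS]modn_small; first by rewrite addnC.
have h1 : (y %% p ^ k < p ^ k)%N by rewrite ltn_mod expn_gt0 p_gt0.
have h2 : (y %/ p ^ k %% p < p)%N by rewrite ltn_mod.
have := leq_mul h2 (leqnn (p ^ k)); rewrite mulSn expnS; lia.
Qed.

Lemma card_lift_residue j k (a : nat) : (j <= k)%N -> (a < p ^ j)%N ->
  #|[pred b : 'I_(p ^ k) | (b %% p ^ j == a)%N]| = (p ^ (k - j))%N.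
Proof.
move=> jk aj; rewrite -[RHS]card_ord.
have kE : (p ^ k = p ^ (k - j) * p ^ j)%N by rewrite -expnD subnK.
have lt (c : 'I_(p ^ (k - j))) : (c * p ^ j + a < p ^ k)%N.
  by rewrite kE; have := leq_mul (ltn_ord c) (leqnn (p ^ j)); rewrite mulSn; lia.
have inj : injective (fun c => Ordinal (lt c)).
  move=> c d [/addIn/eqP]; rewrite eqn_pmul2r ?expn_gt0 ?p_gt0 // => /eqP cd.
  exact: val_inj.
rewrite -(card_imset _ inj); apply: eq_card => b; rewrite inE.
apply/eqP/imsetP => [ba|[c _ ->]]; last by rewrite /= modnMDl modn_small.
have bj : (b %/ p ^ j < p ^ (k - j))%N by rewrite ltn_divLR ?expn_gt0 ?p_gt0 // -kE.
by exists (Ordinal bj) => //; apply: val_inj; rewrite /= -ba -divn_eq.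
Qed.

End Digits.

(** * Integer congruences and the rings Z/p^k *)

Section Congruences.
Variables (p : nat).
Hypothesis p_pr : prime p.
Let p_gt0 := prime_gt0 p_pr.

Lemma congE k a b : cong p k a b = ((p ^ k)%N%:Z %| a - b)%Z.
Proof. by rewrite /cong eqz_mod_dvd. Qed.

(** ['Z_1] is the ring with two elements, so k = 0 has to be excluded here; congruences mod p^0 are
    treated apart below. *)
Lemma cong_intr k a b : (0 < k)%N ->
  cong p k a b = (a%:~R == b%:~R :> 'Z_(p ^ k)).
Proof.
move=> k0; rewrite congE -subr_eq0 -rmorphB /=; set d := a - b.
case: (intP d) => [|n|n].
- by rewrite dvdz0 mulr0z eqxx.
- by rewrite -[n.+1%:~R]/(n.+1%:R) Zpk_natr_eq0.
by rewrite mulrNz oppr_eq0 dvdzE abszN; apply/esym/Zpk_natr_eq0.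
Qed.

Lemma cong_le j k a b : (j <= k)%N -> cong p k a b -> cong p j a b.
Proof.
move=> jk; rewrite !congE; apply: dvdz_trans.
by rewrite dvdzE /= dvdn_exp2l.
Qed.

Lemma truncE (x : padicInt p) k : trunc x k = (residue x k)%:Z.
Proof. by []. Qed.

Lemma trunc_cong (x : padicInt p) j k : (j <= k)%N -> cong p j (trunc x k) (trunc x j).
Proof.
move=> jk; rewrite /cong !truncE !modz_nat residue_mod //.
by rewrite modn_small ?residue_lt.
Qed.

Lemma trunc_intr (x : padicInt p) j k : (0 < j)%N -> (j <= k)%N ->
  (trunc x k)%:~R = (trunc x j)%:~R :> 'Z_(p ^ j).
Proof. by move=> j0 jk; apply/eqP; rewrite -cong_intr // trunc_cong. Qed.

(** Turns divisibility by p^nu in Z/p^k into divisibility of integers, so that it can be transferred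
    to another modulus. *)
Lemma intr_dvd nu k (a : int) (y : 'Z_(p ^ k)) : (0 < k)%N -> (nu <= k)%N ->
  a%:~R = p%:R ^+ nu * y -> exists t : int, a = (p ^ nu)%N%:Z * t.
Proof.
move=> k0 nk; have [c ->] := Zpk_natP y => ac.
have /(cong_le nk) : cong p k a ((p ^ nu * c)%N%:Z).
  by rewrite cong_intr // ac -natrX -natrM.
rewrite congE PoszM => h.
have /dvdzP[t tE] : ((p ^ nu)%N%:Z %| a)%Z.
  by rewrite -[a](subrK ((p ^ nu)%N%:Z * c%:Z)) rpredD ?dvdz_mulr.
by exists t; rewrite tE mulrC.
Qed.

End Congruences.

(** * The Gram matrix of the lattice *)

Section GramMatrix.
Variables (p m nu : nat) (eps : nat -> padicInt p) (s : nat).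
Local Notation r := (m + 2 * s)%N.

Definition hyperbolic (i j : nat) : bool :=
  [&& (i < j)%N, (m <= i)%N, ~~ odd (i - m) & j == i.+1].

Definition diag_coef (k i : nat) : int :=
  if (i < m.-1)%N then trunc (eps i) k
  else if i == m.-1 then (p ^ nu)%N%:Z * trunc (eps m.-1) k else 0.

(** Indices are natural numbers, so that deleting an index or splitting off a hyperbolic plane
    involves no casts. *)
Definition gram_entry (k i j : nat) : int :=
  if i == j then 2 * diag_coef k i else (hyperbolic i j || hyperbolic j i)%:R.

Lemma qcoefE k (i j : 'I_r) : qcoef p m nu eps s k i j =
  if i == j :> nat then diag_coef k i else (hyperbolic i j)%:R.
Proof. by rewrite /qcoef /hyperbolic; case: ifP => // _; case: ifP. Qed.

Let uq k (i j : 'I_r) : int := if (i <= j)%N then qcoef p m nu eps s k i j else 0.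

Let QvalE k v : Qval nu eps k v = \sum_i \sum_j uq k i j * (v i * v j).
Proof.
apply: eq_bigr => i _; rewrite big_mkcond; apply: eq_bigr => j _; rewrite /uq.
by case: ifP => _; rewrite ?mul0r ?mulrA.
Qed.

Let uqD k i j : uq k i j + uq k j i = gram_entry k i j.
Proof.
rewrite /uq !qcoefE /gram_entry.
case: ltngtP => [ij|ij|->]; rewrite ?eqxx.
- by rewrite /hyperbolic [(j < i)%N]ltnNge (ltnW ij) /= orbF addr0.
- by rewrite /hyperbolic [(i < j)%N]ltnNge (ltnW ij) /= add0r.
- by rewrite mulrDl mul1r.
Qed.

Lemma BvalE k (v w : 'I_r -> int) : Bval nu eps k v w = \sum_i \sum_(j < r) v i * gram_entry k i j * w j.
Proof.
rewrite /Bval !QvalE -!sumrB.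
transitivity (\sum_i \sum_j (uq k i j * (v i * w j) + uq k i j * (w i * v j))).
  apply: eq_bigr => i _; rewrite -!sumrB; apply: eq_bigr => j _; ring.
under eq_bigr do rewrite big_split.
rewrite big_split /= [X in _ + X]exchange_big -big_split; apply: eq_bigr => i _.
rewrite -big_split; apply: eq_bigr => j _ /=; rewrite -uqD; ring.
Qed.

Lemma QvalD k (v : 'I_r -> int) : 2 * Qval nu eps k v = Bval nu eps k v v.
Proof.
rewrite BvalE QvalE mulrDl mul1r [X in _ + X]exchange_big -big_split.
apply: eq_bigr => i _; rewrite -big_split; apply: eq_bigr => j _ /=; rewrite -uqD; ring.
Qed.

Lemma gramE k : gram m nu eps s k = \matrix_(i, j) gram_entry k i j.
Proof.
apply/matrixP => a b; rewrite !mxE BvalE.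
have basis0 (c i : 'I_r) : i != c -> basisv c i = 0 by rewrite /basisv eq_sym => /negbTE->.
have basis1 (c : 'I_r) : basisv c c = 1 by rewrite /basisv eqxx.
rewrite (bigD1 a) //= [X in _ + X]big1 ?addr0; last first.
  by move=> i ia; apply: big1 => j _; rewrite (basis0 a i ia) !mul0r.
rewrite (bigD1 b) //= [X in _ + X]big1 ?addr0; last by move=> j jb; rewrite (basis0 b j jb) mulr0.
by rewrite !basis1 mul1r mulr1.
Qed.

Lemma gram_entryC k i j : gram_entry k i j = gram_entry k j i.
Proof. by rewrite /gram_entry eq_sym orbC; case: eqP => // ->. Qed.

(* The j-th row holds the coordinates of g e_j, so that congruence of forms
   reads M G M^T = G. *)
Definition row_mx_of (g : Mat m s -> padicInt p) (k : nat) : 'M[int]_r :=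
  \matrix_(j, i) trunc (g (i, j)) k.

Lemma row_mx_ofE g k : row_mx_of g k = (mat_tr g k)^T.
Proof. by apply/matrixP => i j; rewrite !mxE. Qed.

Lemma row_mx_of_form g k j l :
  (row_mx_of g k *m gram m nu eps s k *m (row_mx_of g k)^T) j l =
  Bval nu eps k (col_tr g k j) (col_tr g k l).
Proof.
rewrite BvalE gramE mxE exchange_big; apply: eq_bigr => i _ /=.
by rewrite !mxE mulr_suml; apply: eq_bigr => a _; rewrite !mxE.
Qed.

Hypotheses (p_pr : prime p) (p_odd : p != 2%N).

(** The Gram matrix doubles the diagonal coefficients of Q; as p is odd, 2 can be cancelled mod
    p^k. *)
Lemma near_fibreP k g : near_fibre nu eps k g <->
  forall j l, cong p k ((row_mx_of g k *m gram m nu eps s k *m (row_mx_of g k)^T) j l)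
                       (gram m nu eps s k j l).
Proof.
have cong2 (a b : int) : cong p k (2 * a) (2 * b) = cong p k a b.
  rewrite !congE -mulrBr Gauss_dvdzr // coprimezE /= coprimeXl //.
  by rewrite prime_coprime // dvdn_prime2.
have BC (v w : 'I_r -> int) : Bval nu eps k v w = Bval nu eps k w v.
  by rewrite /Bval; under [X in Qval _ _ _ X]eq_fun do rewrite addrC; ring.
split=> H j l.
  rewrite row_mx_of_form gramE mxE.
  wlog jl : j l / (j <= l)%N.
    move=> W; case: (leqP j l) => [/W//|/ltnW/W].
    by rewrite BC gram_entryC.
  have := H j l jl; rewrite qcoefE /gram_entry; case: (eqVneq (j : nat) l) => [jl'|jl'].
    have -> : l = j by exact/val_inj.
    by rewrite eqxx -cong2 QvalD.
  have -> : (j == l) = false by apply/negbTE.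
  have -> : hyperbolic l j = false by rewrite /hyperbolic ltnNge jl.
  by rewrite orbF.
move=> jl; have := H j l; rewrite row_mx_of_form gramE mxE qcoefE /gram_entry.
case: (eqVneq (j : nat) l) => [jl'|jl'].
  have -> : l = j by exact/val_inj.
  by rewrite eqxx -[in X in _ -> X]cong2 QvalD.
have -> : (j == l) = false by apply/negbTE.
have -> : hyperbolic l j = false by rewrite /hyperbolic ltnNge jl.
by rewrite orbF.
Qed.

End GramMatrix.

Section Reindexing.
Variables (A : comRingType) (a b : nat) (h : 'I_a -> 'I_b).
Hypothesis h_bij : bijective h.

Lemma mxsub_mul (M N : 'M[A]_b) : mxsub h h (M *m N) = mxsub h h M *m mxsub h h N.
Proof.
apply/matrixP => i j; rewrite !mxE (reindex h) /=; last exact: onW_bij.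
by apply: eq_bigr => c _; rewrite !mxE.
Qed.

Lemma det_mxsub (M : 'M[A]_b) : \det (mxsub h h M) = \det M.
Proof.
have ab : a = b by rewrite -(card_ord a) -(card_ord b); exact: bij_eq_card h_bij.
move: h h_bij M; rewrite ab => f f_bij M; have f_inj := bij_inj f_bij.
have -> : mxsub f f M = row_perm (perm f_inj) (col_perm (perm f_inj) M).
  by apply/matrixP => i j; rewrite !mxE !permE.
rewrite row_permE col_permE !det_mulmx !det_perm odd_permV.
by rewrite mulrCA -signr_addb addbb mulr1.
Qed.

End Reindexing.

(** The last diagonal block is the Gram matrix of a hyperbolic plane, of determinant -1, and the
    block above it is zero. *)
Lemma det_hyperbolic_step (A : comRingType) (f : nat -> nat -> A) N :
  (forall i j, (i < N)%N -> (N <= j)%N -> f i j = 0) ->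
  f N N = 0 -> f N N.+1 = 1 -> f N.+1 N = 1 -> f N.+1 N.+1 = 0 ->
  \det (\matrix_(i < N + 2, j < N + 2) f i j) = - \det (\matrix_(i < N, j < N) f i j).
Proof.
move=> f0 f00 f01 f10 f11.
set M := \matrix_(i, j) _; rewrite -[M]submxK.
have -> : ursubmx M = 0.
  by apply/matrixP => i j; rewrite !mxE /= f0 // leq_addr.
rewrite det_lblock.
have -> : \det (drsubmx M) = -1.
  rewrite (expand_det_row _ 0) big_ord_recl big_ord1 /cofactor !det_mx11 !mxE /=.
  by rewrite !(addn0, addn1) f00 f01 f10; ring.
by rewrite mulrN1; congr (- \det _); apply/matrixP => i j; rewrite !mxE.
Qed.

(** * Splitting off the special line from its unimodular complement *)

Section UnitPart.
Variables (p m nu : nat) (eps : nat -> padicInt p) (s : nat).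
Hypothesis m_ge2 : (2 <= m)%N.
Local Notation r := (m + 2 * s)%N.
Local Notation n := (r.-1).

Definition unit_entry (k i j : nat) : int := gram_entry m nu eps k (bump m.-1 i) (bump m.-1 j).

Lemma det_unit_part k : \det (\matrix_(i < n, j < n) unit_entry k i j) =
  (-1) ^+ s * \prod_(j < m.-1) (2 * trunc (eps j) k).
Proof.
have -> : n = (m.-1 + 2 * s)%N by lia.
elim: (s) => [|t IHt].
  rewrite muln0 addn0 expr0 mul1r.
  have bumpE (i : 'I_m.-1) : bump m.-1 i = i by rewrite /bump leqNgt ltn_ord.
  transitivity (\det (diag_mx (\row_(j < m.-1) (2 * trunc (eps j) k)))).
    congr (\det _); apply/matrixP => i j; rewrite !mxE /unit_entry !bumpE /gram_entry.
    rewrite /diag_coef ltn_ord -val_eqE /=; case: eqP => // _.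
    have mi (l : 'I_m.-1) : (m <= l)%N = false by have := ltn_ord l; lia.
    by rewrite /hyperbolic !mi !andbF.
  by rewrite det_diag; apply: eq_bigr => j _; rewrite mxE.
have -> : (m.-1 + 2 * t.+1 = m.-1 + 2 * t + 2)%N by lia.
have b0 j : bump m.-1 (m.-1 + 2 * t + j) = (m + 2 * t + j)%N.
  by rewrite /bump; lia.
have h0 i : hyperbolic m i i = false by rewrite /hyperbolic ltnn.
have d0 i : (m <= i)%N -> diag_coef m nu eps k i = 0.
  by move=> mi; rewrite /diag_coef !ifF //; lia.
rewrite det_hyperbolic_step ?IHt ?exprS ?mulN1r ?mulNr //.
- move=> i j iN Nj; rewrite /unit_entry /gram_entry.
  have ij : (bump m.-1 i < bump m.-1 j)%N by rewrite /bump; lia.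
  rewrite ltn_eqF // /hyperbolic [(bump _ j < _)%N]ltnNge (ltnW ij) orbF.
  case: andP => // -[_ /and3P[mi ev /eqP je]].
  move: mi ev je Nj iN; rewrite /bump; lia.
- by have := b0 0%N; rewrite !addn0 /unit_entry => ->; rewrite /gram_entry eqxx d0 ?mulr0 // leq_addr.
- have := b0 0%N; have := b0 1%N; rewrite !addn0 !addn1 /unit_entry => -> ->.
  rewrite /gram_entry ltn_eqF // /hyperbolic ltnSn leq_addr addKn oddM eqxx //.
- have := b0 0%N; have := b0 1%N; rewrite !addn0 !addn1 /unit_entry => -> ->.
  rewrite /gram_entry gtn_eqF // /hyperbolic ltnSn leq_addr addKn oddM eqxx orbT //.
- have := b0 1%N; rewrite !addn1 /unit_entry => ->; rewrite /gram_entry eqxx d0 ?mulr0 //; lia.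
Qed.

Lemma special_lt : (m.-1 < r)%N.
Proof. by lia. Qed.

Definition special : 'I_r := Ordinal special_lt.

(** Lists e_(m-1) first and then the other basis vectors in order, which brings the Gram matrix to
    the shape of [degenerate_form]. *)
Definition block_index (a : 'I_(1 + n)) : 'I_r :=
  match fintype.split a with inl _ => special | inr j => lift special j end.

Lemma block_index0 (a : 'I_1) : block_index (lshift n a) = special.
Proof. by rewrite /block_index (unsplitK (inl a)). Qed.

Lemma block_index_at0 : block_index 0 = special.
Proof. by rewrite -(block_index0 0); congr block_index; apply: val_inj. Qed.

Lemma block_indexS (j : 'I_n) : block_index (rshift 1 j) = lift special j.
Proof. by rewrite /block_index (unsplitK (inr j)). Qed.

Lemma rank_predK : (n.+1 = r)%N.
Proof. by lia. Qed.

Lemma block_index_bij : bijective block_index.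
Proof.
apply: inj_card_bij; last by rewrite !card_ord add1n rank_predK.
move=> a b; case: (split_ordP a) => a' ->; case: (split_ordP b) => b' ->.
- by rewrite !ord1.
- by rewrite block_index0 block_indexS => /eqP; rewrite (negbTE (neq_lift _ _)).
- by rewrite block_index0 block_indexS => /esym/eqP; rewrite (negbTE (neq_lift _ _)).
- by rewrite !block_indexS => /lift_inj ->.
Qed.

Definition unit_mx k : 'M[int]_n := \matrix_(i, j) unit_entry k i j.

Lemma gram_entry_special k i : i != m.-1 -> gram_entry m nu eps k m.-1 i = 0.
Proof.
move=> im; rewrite /gram_entry eq_sym (negbTE im) /hyperbolic.
have -> : (m <= m.-1)%N = false by lia.
rewrite andbF /=; case h1: (i < m.-1)%N => //=.
by have -> : (m <= i)%N = false by lia.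
Qed.

Lemma mxsub_gram k : mxsub block_index block_index (gram m nu eps s k) =
  block_mx (2 * ((p ^ nu)%N%:Z * trunc (eps m.-1) k))%:M 0 0 (unit_mx k).
Proof.
have g0 j : gram_entry m nu eps k m.-1 (bump m.-1 j) = 0.
  by rewrite gram_entry_special // eq_sym neq_bump.
rewrite gramE -[LHS]submxK; congr block_mx; apply/matrixP => i j; rewrite !mxE /=.
- rewrite !block_index0 /gram_entry eqxx /diag_coef ltnn eqxx !ord1 eqxx mulr1n //.
- by rewrite block_index0 block_indexS g0.
- by rewrite block_index0 block_indexS gram_entryC g0.
- by rewrite !block_indexS.
Qed.

Lemma det_gram k : \det (gram m nu eps s k) =
  2 * ((p ^ nu)%N%:Z * trunc (eps m.-1) k) * \det (unit_mx k).
Proof. by rewrite -(det_mxsub block_index_bij) mxsub_gram det_lblock det_scalar1. Qed.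

Hypotheses (p_pr : prime p) (p_odd : p != 2%N).
Hypothesis eps_unit : forall j, (j < m)%N -> (eps j 0%N : nat) != 0%N.
Let p_gt0 := prime_gt0 p_pr.

Lemma Fp_intr_eq0 (a : int) : (a%:~R == 0 :> 'F_p) = (p%:Z %| a)%Z.
Proof.
case: (intP a) => [|l|l].
- by rewrite dvdz0 mulr0z eqxx.
- exact: Fp_natr_eq0.
- by rewrite mulrNz oppr_eq0 dvdzE abszN; apply: Fp_natr_eq0.
Qed.

Lemma trunc_Fp (x : padicInt p) k : (0 < k)%N -> (trunc x k)%:~R = (x 0%N : nat)%:R :> 'F_p.
Proof.
move=> k0; have := residue_mod p_gt0 x k0.
rewrite truncE -[_%:~R]/((residue x k)%:R) {2}/residue big_ord1 muln1 expn1 => <-.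
by rewrite [in LHS](divn_eq (residue x k) p) natrD natrM pchar_Fp_0 // mulr0 add0r.
Qed.

Lemma trunc_eps_neq0 k j : (0 < k)%N -> (j < m)%N -> (trunc (eps j) k)%:~R != 0 :> 'F_p.
Proof.
move=> k0 jm; rewrite trunc_Fp // Fp_natr_eq0 // gtnNdvd ?ltn_ord // lt0n.
exact: eps_unit.
Qed.

Lemma unit_part_Fp k : (0 < k)%N ->
  (\det (\matrix_(i < n, j < n) unit_entry k i j))%:~R != 0 :> 'F_p.
Proof.
move=> k0; rewrite det_unit_part rmorphM rmorph_prod rmorphXn rmorphN1 /= mulf_neq0 //.
  by rewrite expf_neq0 // oppr_eq0 oner_neq0.
apply/prodf_neq0 => j _; rewrite rmorphM mulf_neq0 ?trunc_eps_neq0 //.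
  exact: Fp_two_neq0.
by apply: leq_trans (ltn_ord j) _; exact: leq_pred.
Qed.

End UnitPart.

Local Open Scope classical_set_scope.

(** * Compactness and Haar measure *)

(* The limit of u along a non-principal ultrafilter is taken digit by digit. *)
Lemma padic_cluster (p : nat) (I : finType) (u : nat -> I -> padicInt p) :
  exists x, forall k N, exists2 n, (N <= n)%N & cyl x k (u n).
Proof.
have [G [GU ooG]] := @ultraFilterLemma nat \oo _.
have digit i t : exists a, G [set n | u n i t = a].
  apply: contrapT => /forallNP na.
  have Gn a : G [set n | u n i t <> a].
    by case: (@in_ultra_setVsetC _ _ [set n | u n i t = a] GU) => // /na.
  have : G [set n | forall a, u n i t <> a] by apply: filter_forall => a; exact: Gn.
  by move=> /filter_ex[n /(_ (u n i t))].
have /choice[f fE] : forall it : I * nat, exists a, G [set n | u n it.1 it.2 = a].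
  by case=> i t; exact: digit.
exists (fun i t => f (i, t)) => k N.
have Gk : G [set n | forall it : I * 'I_k, u n it.1 it.2 = f (it.1, it.2 : nat)].
  by apply: filter_forall => -[i t]; exact: (fE (i, t : nat)).
have GN : G [set n | (N <= n)%N] by apply: ooG; exact: nbhs_infty_ge.
have [n [nN nk]] := filter_ex (filterI GN Gk); exists n => //.
by move=> i t tk; have := nk (i, Ordinal tk).
Qed.

(** * Haar measure of a union of residue classes *)

Section Haar.
Variables (R : realType) (p : nat) (I : finType).
Hypothesis p_gt1 : (1 < p)%N.
Hypothesis I_gt0 : (0 < #|I|)%N.
Let p_gt0 : (0 < p)%N := ltnW p_gt1.
Local Notation vec := (I -> padicInt p).

Definition residues (k : nat) (x : vec) : {ffun I -> 'I_(p ^ k)} :=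
  [ffun i => Ordinal (residue_lt p_gt0 (x i) k)].

Definition vec_of k (f : {ffun I -> 'I_(p ^ k)}) : vec := fun i => digits_of p_gt0 (f i).

Lemma vec_ofK k (f : {ffun I -> 'I_(p ^ k)}) : residues k (vec_of f) = f.
Proof.
apply/ffunP => i; rewrite ffunE; apply: val_inj => /=.
by rewrite residue_digits_of modn_small.
Qed.

Lemma residues_eqP k x y : residues k x = residues k y <-> cyl y k x.
Proof.
split=> [/ffunP xy i t|xy].
  by have := xy i; rewrite !ffunE => -[/(residue_eq_digits p_gt0)]; apply.
by apply/ffunP => i; rewrite !ffunE; apply: val_inj; apply: residue_ext => t; exact: xy.
Qed.

Definition level_set k (P : pred {ffun I -> 'I_(p ^ k)}) : set vec :=
  [set x | P (residues k x)].

Lemma card_level_lift j k (a : vec) : (j <= k)%N ->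
  #|[pred f : {ffun I -> 'I_(p ^ k)} | `[< cyl a j (vec_of f) >]]| = (p ^ ((k - j) * #|I|))%N.
Proof.
move=> jk; rewrite expnM.
rewrite -(eq_card (A := family (fun i => [pred b : 'I_(p ^ k) | (b %% p ^ j == residue (a i) j)%N]))).
  rewrite card_family foldrE big_map (eq_bigr (fun=> p ^ (k - j))%N).
    by rewrite big_const_seq count_predT -cardE iter_muln_1.
  by move=> i _; apply: card_lift_residue => //; exact: residue_lt.
move=> f; rewrite !inE; apply/forallP/asboolP => [fa|/residues_eqP/ffunP fa i].
  apply/residues_eqP/ffunP => i; rewrite !ffunE; apply: val_inj => /=.
  by rewrite residue_digits_of; have := fa i; rewrite inE => /eqP.
by have := fa i; rewrite !ffunE inE => -[<-]; rewrite residue_digits_of.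
Qed.

Lemma card_level_refine j k (P : pred {ffun I -> 'I_(p ^ j)}) : (j <= k)%N ->
  #|[pred f : {ffun I -> 'I_(p ^ k)} | P (residues j (vec_of f))]| =
  (#|P| * p ^ ((k - j) * #|I|))%N.
Proof.
move=> jk; rewrite -[LHS]sum1_card (partition_big (fun f : {ffun I -> 'I_(p ^ k)} => residues j (vec_of f)) P) //=.
rewrite -sum_nat_const; apply: eq_bigr => g Pg.
rewrite sum1_card -(card_level_lift (vec_of g) jk); apply: eq_card => f; rewrite !inE.
apply/andP/asboolP => [[_ /eqP fg]|/residues_eqP]; first by apply/residues_eqP; rewrite vec_ofK.
by rewrite vec_ofK => fg; split; [move: Pg; rewrite -fg|apply/eqP].
Qed.

(** Otherwise choose for each N a point of the level set outside the first N balls. A cluster point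
    lies in the level set, hence in some ball, which then contains a later chosen point that avoids
    it. *)
Lemma finite_subcover k (P : pred {ffun I -> 'I_(p ^ k)}) (c : nat -> vec * nat) :
  level_set P `<=` \bigcup_n cyl (c n).1 (c n).2 ->
  exists N, level_set P `<=` [set x | exists2 n, (n < N)%N & cyl (c n).1 (c n).2 x].
Proof.
move=> Pc; apply: contrapT => /forallNP nN.
have /choice[u uE] : forall N, exists x, level_set P x /\
    forall n, (n < N)%N -> ~ cyl (c n).1 (c n).2 x.
  move=> N; apply: contrapT => /forallNP nx; apply: (nN N) => x Px.
  apply: contrapT => xN; apply: (nx x); split=> // n nN' cx; apply: xN.
  by exists n.
have [x xE] := padic_cluster u.
have Px : level_set P x.
  have [n _ /residues_eqP xn] := xE k 0%N; have [] := uE n.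
  by rewrite /level_set /= xn.
have [n _ cx] := Pc x Px.
have [j jn xj] := xE (c n).2 n.+1.
have [_ /(_ n jn)] := uE j; apply => i t tn.
by rewrite xj // cx.
Qed.

Let w (k : nat) : R := p%:R ^- (k * #|I|)%N.

Lemma w_gt0 k : 0 < w k.
Proof. by rewrite invr_gt0 exprn_gt0 // ltr0n. Qed.

Lemma haar_level_ge k (P : pred {ffun I -> 'I_(p ^ k)}) :
  (((#|P|)%:R * w k)%:E <= haar R (level_set P))%E.
Proof.
apply/ereal_infP => _ [c /= Pc <-].
have [N PN] := finite_subcover Pc.
apply: (@le_trans _ _ (\sum_(0 <= n < N) (w (c n).2)%:E)%E); last first.
  by apply: nneseries_lim_ge => n _ _; rewrite lee_fin ltW // w_gt0.
rewrite sumEFin lee_fin big_mkord.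
(* A common level: mod p^K both the level set and the N balls are unions of residue classes, and the
   inequality becomes a count. *)
pose K := (k + \max_(n < N) (c n).2)%N.
have kK : (k <= K)%N by rewrite leq_addr.
have cK (n : 'I_N) : ((c n).2 <= K)%N.
  by apply: leq_trans (leq_addl _ _); apply: (@leq_bigmax _ (fun n : 'I_N => (c n).2)).
have card_le : (#|P| * p ^ ((K - k) * #|I|) <= \sum_(n < N) p ^ ((K - (c n).2) * #|I|))%N.
  rewrite -(card_level_refine P kK).
  under eq_bigr => n _ do rewrite -(card_level_lift (c n).1 (cK n)).
  pose B (n : 'I_N) := [set f : {ffun I -> 'I_(p ^ K)} | `[< cyl (c n).1 (c n).2 (vec_of f) >]]%SET.
  have Bsub : [set f : {ffun I -> 'I_(p ^ K)} | P (residues k (vec_of f))]%SET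
      \subset \big[@finset.setU _/finset.set0]_n B n.
    apply/fintype.subsetP => f; rewrite inE => Pf.
    have [n nN cf] := PN (vec_of f) Pf.
    by apply/finset.bigcupP; exists (Ordinal nN) => //; rewrite inE; apply/asboolP.
  have -> : #|[pred f : {ffun I -> 'I_(p ^ K)} | P (residues k (vec_of f))]| =
     #|[set f : {ffun I -> 'I_(p ^ K)} | P (residues k (vec_of f))]%SET|.
    by rewrite cardsE.
  apply: (leq_trans (subset_leq_card Bsub)).
  apply: (@big_ind2 _ _ (fun (X : {set {ffun I -> 'I_(p ^ K)}}) m => #|X| <= m)%N).
  - by rewrite cards0.
  - by move=> X m Y l Xm Yl; apply: (leq_trans (leq_card_setU _ _)); exact: leq_add.
  - by move=> n _; rewrite /B cardsE.
have wE j : (j <= K)%N -> w j = (p ^ ((K - j) * #|I|))%:R * w K.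
  move=> jK; rewrite /w natrX -[in RHS](subnK jK) mulnDl addnK exprD invfM mulrA divff ?mul1r //.
  by rewrite expf_neq0 // pnatr_eq0 -lt0n.
rewrite wE // mulrA -natrM (eq_bigr (fun n : 'I_N => (p ^ ((K - (c n).2) * #|I|))%:R * w K)); last first.
  by move=> n _; rewrite wE.
by rewrite -big_distrl /= -natr_sum ler_pM2r ?w_gt0 // ler_nat.
Qed.

Lemma haar_level_le k (P : pred {ffun I -> 'I_(p ^ k)}) :
  (haar R (level_set P) <= ((#|P|)%:R * w k)%:E)%E.
Proof.
apply/lee_addgt0Pr => e e0.
pose h : R := 2%:R^-1.
have h01 : 0 < h < 1 by rewrite invr_gt0 ltr0n invf_lt1 ?ltr0n // ltr1n.
have [K hK] : exists K, 2%:R * h ^+ K < e.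
  exists (Num.bound (2%:R / e)); set K := Num.bound _.
  have eK : 2%:R / e < K%:R by apply: archi_boundP; rewrite divr_ge0 ?ler0n // ltW.
  have K2 : K%:R < 2%:R ^+ K :> R by rewrite -natrX ltr_nat ltn_expl.
  rewrite /h exprVn ltr_pdivrMr ?exprn_gt0 ?ltr0n // mulrC -ltr_pdivrMr //.
  exact: lt_trans K2.
have w_h j : w j <= h ^+ j.
  rewrite /w /h exprVn lef_pV2 ?posrE ?exprn_gt0 ?ltr0n // -!natrX ler_nat.
  apply: (@leq_trans (p ^ j)); first by case: (j) => // i; rewrite leq_exp2r.
  by rewrite leq_exp2l // -{1}[j]muln1 leq_mul2l I_gt0 orbT.
pose s := enum P.
pose x0 : vec := fun _ => digits_of p_gt0 0.
(* Covers are infinite sequences, so the finite cover by the classes in P is continued by balls of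
   level K + n. As I is nonempty, these have volume at most 2^-(K + n), in total at most 2 * 2^-K <
   e. *)
pose c n := if (n < size s)%N then (nth x0 [seq vec_of f | f <- s] n, k) else (x0, K + n)%N.
apply: ge_ereal_inf; exists (\sum_(0 <= n <oo) (w (c n).2)%:E)%E.
  exists c => // x Px.
  have xs : residues k x \in s by rewrite mem_enum.
  exists (index (residues k x) s) => //; rewrite /c index_mem xs /=.
  rewrite (nth_map (residues k x)) ?index_mem // nth_index //.
  by apply/residues_eqP; rewrite vec_ofK.
have w_ge0 n : (0 <= (w (c n).2)%:E)%E by rewrite lee_fin ltW ?w_gt0.
apply: lime_le; first by apply: is_cvg_nneseries => n _ _.
apply: nearW => N; rewrite sumEFin -EFinD lee_fin.
apply: (@le_trans _ _ (\sum_(0 <= n < N) ((n < size s)%:R * w k + h ^+ (K + n)))).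
  apply: ler_sum => n _; rewrite /c; case: ltnP => _ /=.
    by rewrite mul1r lerDl exprn_ge0 // ltW //; case/andP: h01.
  by rewrite mul0r add0r w_h.
rewrite big_split /= -big_distrl /=; apply: lerD.
  rewrite ler_pM2r ?w_gt0 // -natr_sum ler_nat.
  rewrite [leqRHS]cardE -/s; apply: (@leq_trans (minn N (size s))); last exact: geq_minr.
  elim: N => [|N IHN]; first by rewrite big_geq.
  rewrite big_nat_recr //= (leq_trans (leq_add IHN (leqnn _))) //.
  by move: (size s) => l; case: ltnP => lN; lia.
apply: le_trans (ltW hK).
have -> : 2%:R * h ^+ K = \sum_(0 <= n < N) h ^+ (K + n) + 2%:R * h ^+ (K + N).
  elim: N => [|N IHN]; first by rewrite big_geq // add0r addn0.
  rewrite big_nat_recr //= {}IHN -addrA; congr (_ + _).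
  by rewrite addnS exprS /h; field.
by rewrite lerDl mulr_ge0 ?ler0n // exprn_ge0 // ltW //; case/andP: h01.
Qed.

Lemma haar_level k (P : pred {ffun I -> 'I_(p ^ k)}) :
  haar R (level_set P) = ((#|P|)%:R * w k)%:E.
Proof. by apply/eqP; rewrite eq_le haar_level_le haar_level_ge. Qed.

Lemma le_haar (S T : set vec) : S `<=` T -> (haar R S <= haar R T)%E.
Proof.
move=> ST; apply: ereal_inf_le_tmp => _ [c Tc <-]; exists c => //.
exact: subset_trans Tc.
Qed.

Lemma haar_fin (S : set vec) : haar R S \is a fin_num.
Proof.
have S1 : (haar R S <= ((#|@predT {ffun I -> 'I_(p ^ 0)}|)%:R * w 0)%:E)%E.
  by rewrite -haar_level; apply: le_haar.
rewrite ge0_fin_numE; first exact: le_lt_trans S1 (ltry _).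
apply/ereal_infP => _ [c _ <-]; apply: nneseries_ge0 => n _ _.
by rewrite lee_fin ltW ?w_gt0.
Qed.

Lemma le_fine_haar (S T : set vec) : S `<=` T -> fine (haar R S) <= fine (haar R T).
Proof. by move=> /le_haar; apply: fine_le; exact: haar_fin. Qed.

Lemma fine_haar_level k (P : pred {ffun I -> 'I_(p ^ k)}) :
  fine (haar R (level_set P)) = (#|P|)%:R * p%:R ^- (k * #|I|)%N.
Proof. by rewrite haar_level. Qed.

End Haar.

(** * The discriminant kernel as an intersection of neighbourhoods *)

Section NearFibre.
Variables (p m nu : nat) (eps : nat -> padicInt p) (s : nat).
Hypotheses (p_pr : prime p) (p_odd : p != 2%N) (m_ge2 : (2 <= m)%N) (nu_gt0 : (0 < nu)%N).
Hypothesis eps_unit : forall j, (j < m)%N -> (eps j 0%N : nat) != 0%N.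
Local Notation r := (m + 2 * s)%N.
Local Notation n := (r.-1).
Let p_gt0 := prime_gt0 p_pr.
Let p_gt1 := prime_gt1 p_pr.
Local Notation sigma := (@block_index m s m_ge2).
Local Notation vec := (Mat m s -> padicInt p).

(* The first k digits, read modulo p^j. *)
Definition fmx j k (g : vec) : 'M['Z_(p ^ j)]_(1 + n) :=
  map_mx intr (mxsub sigma sigma (row_mx_of g k)).

Definition fcoef k : 'Z_(p ^ k) := (2 * trunc (eps m.-1) k)%:~R.

Definition funit k : 'M['Z_(p ^ k)]_n := map_mx intr (unit_mx m nu eps s k).

Definition fform k := degenerate_form p%:R nu (fcoef k) (funit k).

Lemma gram_entry_intr j k a b : (0 < j)%N -> (j <= k)%N ->
  (gram_entry m nu eps k a b)%:~R = (gram_entry m nu eps j a b)%:~R :> 'Z_(p ^ j).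
Proof.
move=> j0 jk; rewrite /gram_entry /diag_coef; case: ifP => // _.
case: ifP => _; first by rewrite !rmorphM /= (trunc_intr p_pr _ j0 jk).
by case: ifP => _ //; rewrite !rmorphM /= (trunc_intr p_pr _ j0 jk).
Qed.

Lemma fmx_level j k g : (0 < j)%N -> (j <= k)%N -> fmx j k g = fmx j j g.
Proof. by move=> j0 jk; apply/matrixP => a b; rewrite !mxE; apply: trunc_intr. Qed.

Lemma fform_level j k : (0 < j)%N -> (j <= k)%N ->
  map_mx intr (mxsub sigma sigma (gram m nu eps s k)) = fform j.
Proof.
move=> j0 jk; transitivity (map_mx intr (mxsub sigma sigma (gram m nu eps s j)) : 'M['Z_(p ^ j)]_(1 + n)).
  by apply/matrixP => a b; rewrite !gramE !mxE; apply: gram_entry_intr.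
rewrite mxsub_gram // map_block_mx !map_mx0 map_scalar_mx; congr block_mx.
by congr (_%:M); rewrite /fcoef -natrX !rmorphM /= mulrCA.
Qed.

Lemma fmx_formE j k g : map_mx (intr : int -> 'Z_(p ^ j)) (mxsub sigma sigma
    (row_mx_of g k *m gram m nu eps s k *m (row_mx_of g k)^T)) =
  fmx j k g *m map_mx intr (mxsub sigma sigma (gram m nu eps s k)) *m (fmx j k g)^T.
Proof.
have bij := block_index_bij s m_ge2.
rewrite (mxsub_mul bij) (mxsub_mul bij) !map_mxM; congr (_ *m _).
by apply/matrixP => a b; rewrite !mxE.
Qed.

Lemma near_fibre_fmx j k (g : vec) : (0 < j)%N -> (j <= k)%N -> near_fibre nu eps k g ->
  fmx j j g *m fform j *m (fmx j j g)^T = fform j.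
Proof.
move=> j0 jk /(near_fibreP _ _ p_pr p_odd) H.
rewrite -(fmx_level g j0 jk) -(fform_level j0 jk) -fmx_formE.
apply/matrixP => a b; rewrite [LHS]mxE [RHS]mxE [in LHS]mxE [in RHS]mxE.
by apply/eqP; rewrite -cong_intr //; apply: cong_le jk _; apply: H.
Qed.

Lemma fmx_near_fibre k (g : vec) : (0 < k)%N ->
  fmx k k g *m fform k *m (fmx k k g)^T = fform k -> near_fibre nu eps k g.
Proof.
move=> k0; rewrite -(fform_level k0 (leqnn k)) -fmx_formE => H.
have [s' _ sK] := block_index_bij s m_ge2.
apply/(near_fibreP _ _ p_pr p_odd) => a b; rewrite cong_intr //.
move/matrixP/(_ (s' a) (s' b)): H.
by rewrite [LHS]mxE [RHS]mxE [in LHS]mxE [in RHS]mxE !sK => ->.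
Qed.

Lemma near_fibre_le j k (g : vec) : (j <= k)%N -> near_fibre nu eps k g -> near_fibre nu eps j g.
Proof.
case: j => [|j] jk H; first by move=> a b _; rewrite congE expn0 dvd1z.
by apply: fmx_near_fibre => //; exact: near_fibre_fmx H.
Qed.

(** For an isometry both quantities are 1 or -1 mod p, and the conditions fix the two signs. They
    involve first digits only, which makes the set open and closed. *)
Definition identity_component : set vec :=
  [set g | (trunc (g (special s m_ge2, special s m_ge2)) 1)%:~R = 1 :> 'F_p /\
           (\det (row_mx_of g 1))%:~R = 1 :> 'F_p].

Lemma row_mx_of_Fp (g : vec) k : (0 < k)%N ->
  (\det (row_mx_of g k))%:~R = (\det (row_mx_of g 1))%:~R :> 'F_p.
Proof.
move=> k0; rewrite -!(det_map_mx (intr : int -> 'F_p)); congr (\det _).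
by apply/matrixP => a b; rewrite !mxE; transitivity ((g (b, a) 0%N : nat)%:R : 'F_p); [|apply: esym]; apply: trunc_Fp.
Qed.

Lemma identity_componentP k (k0 : (0 < k)%N) (g : vec) : identity_component g <->
  Zpk_reduction p_pr k0 (fmx k k g 0 0) = 1 /\ Zpk_reduction p_pr k0 (\det (fmx k k g)) = 1.
Proof.
rewrite det_map_mx !mxE !rmorph_int (det_mxsub (block_index_bij s m_ge2)).
rewrite block_index_at0; set x := g _.
have tE : (trunc x k)%:~R = (trunc x 1)%:~R :> 'F_p by rewrite !(trunc_Fp p_pr).
have dE := row_mx_of_Fp g k0.
split=> -[h1 h2]; split.
- exact: etrans tE h1.
- exact: etrans dE h2.
- exact: etrans (esym tE) h1.
- exact: etrans (esym dE) h2.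
Qed.

Definition isometry_residues k (k0 : (0 < k)%N) : pred {ffun Mat m s -> 'I_(p ^ k)} :=
  fun f => degenerate_isometries nu p_pr k0 (fcoef k) (funit k)
    (\matrix_(a, b) (f (sigma b, sigma a) : nat)%:R).

Lemma fmx_residues k g : fmx k k g =
  \matrix_(a, b) (residues p_gt1 k g (sigma b, sigma a) : nat)%:R.
Proof. by apply/matrixP => a b; rewrite !mxE ffunE. Qed.

(** Presents the neighbourhood as a union of residue classes mod p^k, so that its Haar measure is a
    count of matrices over Z/p^k. *)
Lemma near_identity_level k (k0 : (0 < k)%N) :
  identity_component `&` near_fibre nu eps k = level_set p_gt1 (isometry_residues k0).
Proof.
rewrite eqEsubset; split=> g; rewrite /level_set /isometry_residues /= -fmx_residues.
  move=> [/(identity_componentP k0)[/eqP g1 /eqP g2] /(near_fibre_fmx k0 (leqnn k))/eqP gG].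
  by apply/and3P.
case/and3P => /eqP gG /eqP g1 /eqP g2; split; first exact/(identity_componentP k0).
exact: fmx_near_fibre.
Qed.

Lemma card_isometry_residues k (k0 : (0 < k)%N) :
  #|isometry_residues k0| = #|degenerate_isometries nu p_pr k0 (fcoef k) (funit k)|.
Proof.
pose h (f : {ffun Mat m s -> 'I_(p ^ k)}) : 'M['Z_(p ^ k)]_(1 + n) :=
  \matrix_(a, b) (f (sigma b, sigma a) : nat)%:R.
have [s' _ sK] := block_index_bij s m_ge2.
have inj : injective h.
  move=> f f' /matrixP ff; apply/ffunP => -[i j].
  have /eqP := ff (s' j) (s' i); rewrite !mxE !sK Zpk_natr_eq //.
  by rewrite !modn_small ?ltn_ord // => /eqP/val_inj.
have hb : bijective h.
  apply: inj_card_bij => //; rewrite card_ffun card_mx card_Zpk // card_ord card_prod card_ord.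
  by rewrite add1n (rank_predK s m_ge2).
rewrite -[RHS]sum1_card (reindex h) /=; last exact: onW_bij.
by rewrite sum1_card; apply: eq_card.
Qed.

End NearFibre.

(** * Comparison of the discriminant kernel with the two conditions mod p *)

Section DiscriminantKernel.
Variables (p m nu : nat) (eps : nat -> padicInt p) (s : nat).
Hypotheses (p_pr : prime p) (p_odd : p != 2%N) (m_ge2 : (2 <= m)%N) (nu_gt0 : (0 < nu)%N).
Hypothesis eps_unit : forall j, (j < m)%N -> (eps j 0%N : nat) != 0%N.
Local Notation r := (m + 2 * s)%N.
Local Notation n := (r.-1).
Let p_gt0 := prime_gt0 p_pr.
Let p_gt1 := prime_gt1 p_pr.
Local Notation sigma := (@block_index m s m_ge2).
Local Notation i0 := (special s m_ge2).
Local Notation vec := (Mat m s -> padicInt p).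
Local Notation fcoef := (fcoef m eps).
Local Notation funit := (funit m nu eps s).
Local Notation fmx := (fmx m_ge2).

Lemma fcoef_unit k : (0 < k)%N -> fcoef k \is a GRing.unit.
Proof.
move=> k0; apply: (@Zpk_red_unit p k p_pr k0); rewrite rmorph_int rmorphM mulf_neq0 //.
  exact: Fp_two_neq0.
by apply: (trunc_eps_neq0 p_pr eps_unit) => //; rewrite ltn_predL (ltnW m_ge2).
Qed.

Lemma funit_sym k : (funit k)^T = funit k.
Proof. by apply/matrixP => i j; rewrite !mxE /unit_entry gram_entryC. Qed.

Lemma funit_unit k : (0 < k)%N -> funit k \in unitmx.
Proof.
move=> k0; rewrite unitmxE det_map_mx; apply: (@Zpk_red_unit p k p_pr k0).
by rewrite rmorph_int unit_part_Fp.
Qed.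

Lemma cong_Fp a b : cong p 1 a b = (a%:~R == b%:~R :> 'F_p).
Proof. by rewrite congE expn1 -subr_eq0 -rmorphB Fp_intr_eq0. Qed.

Lemma trunc_nat (y k : nat) : trunc (digits_of p_gt0 y) k = (y %% p ^ k)%N%:Z.
Proof. by rewrite truncE residue_digits_of. Qed.

Lemma SOprime_identity_component :
  SOprime p m nu eps s `<=` identity_component m_ge2.
Proof.
move=> g [_ [g_det g_disc]]; split; last first.
  by apply/eqP; rewrite -[1]/(1%:~R) -cong_Fp row_mx_ofE det_tr; exact: g_det.
(* The test vector is e_(m-1) / p^nu, which lies in M^*; triviality on it gives g(m-1, m-1) = 1 mod
   p^nu. *)
pose w (j : 'I_r) := digits_of p_gt0 (j == i0).
have wE : (fun j => trunc (w j) nu) = basisv i0.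
  have lt (b : bool) : (b < p ^ nu)%N.
    by apply: (@leq_ltn_trans 1); [case: b|rewrite -(exp1n nu) ltn_exp2r].
  by apply/funext => j; rewrite /w trunc_nat modn_small // /basisv eq_sym natz.
have := g_disc nu w; rewrite wE.
have Bw i : cong p nu (Bval nu eps nu (basisv i0) (basisv i)) 0.
  have /matrixP/(_ i0 i) := gramE m nu eps s nu; rewrite !mxE => ->.
  rewrite congE subr0; case: (eqVneq (i : nat) m.-1) => [ii|ii].
    by rewrite ii /gram_entry eqxx /diag_coef ltnn eqxx mulrCA dvdz_mulr.
  by rewrite gram_entry_special ?dvdz0.
move=> /(_ Bw i0); rewrite (bigD1 i0) //= big1 ?addr0; last first.
  by move=> j ji; rewrite -[trunc (w j) nu]/((fun j => trunc (w j) nu) j) wE /basisv eq_sym (negbTE ji) mulr0.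
rewrite -[trunc (w i0) nu]/((fun j => trunc (w j) nu) i0) wE /basisv eqxx mulr1.
rewrite congE subr0 -congE => /(cong_le nu_gt0); rewrite cong_Fp => /eqP.
by move=> h; apply: etrans h; rewrite !(trunc_Fp p_pr).
Qed.

Lemma det_row_mx_cong (g : vec) j k : (0 < j)%N -> (j <= k)%N ->
  cong p j (\det (row_mx_of g k)) (\det (row_mx_of g j)).
Proof.
move=> j0 jk; rewrite cong_intr // -!det_map_mx; apply/eqP; congr (\det _).
by apply/matrixP => a b; rewrite !mxE; apply: trunc_intr.
Qed.

(** Taking determinants in g G g^T = G only yields p^nu (d^2 - 1) = 0 up to a unit, because det G is
    p^nu times a unit; and d + 1 is a unit since d = 1 mod p. *)
Lemma identity_isometry_det_one (g : vec) :
  identity_component m_ge2 g -> Defs.isometry nu eps g -> det_one g.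
Proof.
move=> g1 giso K; rewrite -det_tr -row_mx_ofE.
have [->|K0] := posnP K; first by rewrite congE expn0 dvd1z.
(* Cancelling p^nu costs nu digits, so precision K requires K + nu. *)
pose k := (K + nu)%N.
have k0 : (0 < k)%N by rewrite /k; lia.
have Kk : (K <= k)%N by rewrite /k; lia.
have nk : (nu <= k)%N by rewrite /k; lia.
suff : cong p K (\det (row_mx_of g k)) 1.
  rewrite !cong_intr // => /eqP <-; rewrite eq_sym -cong_intr //.
  exact: det_row_mx_cong.
have iso := near_fibre_fmx p_pr p_odd m_ge2 k0 (leqnn k) (giso k).
have [_ rd] := (identity_componentP p_pr m_ge2 k0 g).1 g1.
set d := \det (fmx k k g) in rd.
have dE : d = (\det (row_mx_of g k))%:~R.
  by rewrite /d det_map_mx (det_mxsub (block_index_bij s m_ge2)).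
have Gdet : \det (fform m nu eps s k) = p%:R ^+ nu * (fcoef k * \det (funit k)).
  by rewrite det_lblock det_scalar1 mulrA.
have Vu : fcoef k * \det (funit k) \is a GRing.unit.
  by rewrite unitrM fcoef_unit //= -unitmxE funit_unit.
have : p%:R ^+ nu * (fcoef k * \det (funit k) * (d ^+ 2 - 1)) = 0.
  have := congr1 determinant iso; rewrite !det_mulmx det_tr Gdet -/d => h.
  by apply/eqP; rewrite mulrA mulrBr mulr1 subr_eq0; apply/eqP; rewrite -[RHS]h; ring.
case/(Zpk_annihilator p_pr k0 nk) => y yE.
have d1u : d + 1 \is a GRing.unit.
  apply: (@Zpk_red_unit p k p_pr k0); rewrite rmorphD rmorph1 [X in X + _]rd.
  by rewrite -(natrD _ 1 1) Fp_two_neq0.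
have : (\det (row_mx_of g k) - 1)%:~R = p%:R ^+ K * (y / (fcoef k * \det (funit k)) / (d + 1)).
  rewrite rmorphB /= -dE -[1%:~R]/1; apply: (mulIr d1u); rewrite mulrA mulrVK //.
  apply: (mulIr Vu); rewrite mulrA mulrVK //.
  have kK : (k - nu)%N = K by rewrite /k addnK.
  by rewrite -kK -yE; ring.
case/(intr_dvd p_pr k0 Kk) => t tE.
by rewrite congE tE dvdz_mulr.
Qed.

(** Row 0 of [fmx] holds g e_(m-1), so this is g e_(m-1) = e_(m-1) mod p^nu M, triviality on the
    generator of M^*/M. *)
Lemma isometry_special_row (g : vec) N : (0 < N)%N ->
  identity_component m_ge2 g -> Defs.isometry nu eps g ->
  (exists y, fmx N N g 0 0 - 1 = p%:R ^+ nu * y) /\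
  (forall j, exists y, fmx N N g 0 (rshift 1 j) = p%:R ^+ nu * y).
Proof.
(* Large enough for [degenerate_isometry_mod], which needs 2 nu <= k, and for reading the result mod
   p^N. *)
move=> N0 g1 giso; pose k := (N + nu + nu)%N.
have k0 : (0 < k)%N by rewrite /k; lia.
have Nk : (N <= k)%N by rewrite /k; lia.
have nk : (nu <= k)%N by rewrite /k; lia.
have nnk : (nu + nu <= k)%N by rewrite /k; lia.
have iso := near_fibre_fmx p_pr p_odd m_ge2 k0 (leqnn k) (giso k).
have [rd rdet] := (identity_componentP p_pr m_ge2 k0 g).1 g1.
have gD : degenerate_isometries nu p_pr k0 (fcoef k) (funit k) (fmx k k g).
  by apply/and3P; split; apply/eqP.
have [[b bE] [y yE]] := degenerate_isometry_mod p_odd nu_gt0 (fcoef_unit k0) (funit_sym k)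
   (funit_unit k0) nnk gD.
have lev a c : fmx N N g a c = (trunc (g (sigma c, sigma a)) k)%:~R.
  by rewrite !mxE; apply/esym/trunc_intr.
have pN t : (((p ^ nu)%N%:Z * t)%:~R = p%:R ^+ nu * t%:~R :> 'Z_(p ^ N)).
  by rewrite rmorphM /= -natrX.
split.
  have : (trunc (g (sigma 0, sigma 0)) k - 1)%:~R = p%:R ^+ nu * y.
    by rewrite rmorphB /= -yE !mxE.
  case/(intr_dvd p_pr k0 nk) => t tE; exists t%:~R.
  by rewrite lev -pN -tE rmorphB.
move=> j; have : (trunc (g (sigma (rshift 1 j), sigma 0)) k)%:~R = p%:R ^+ nu * b 0 j.
  move/matrixP/(_ 0 j): bE; rewrite !mxE => <-.
  by congr (trunc (g (_, sigma _)) k)%:~R; apply: val_inj.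
by case/(intr_dvd p_pr k0 nk) => t tE; exists t%:~R; rewrite lev tE pN.
Qed.

End DiscriminantKernel.

Section FibreNeighbourhoods.
Variables (p m nu : nat) (eps : nat -> padicInt p) (s : nat).
Hypotheses (p_pr : prime p) (p_odd : p != 2%N) (m_ge2 : (2 <= m)%N) (nu_gt0 : (0 < nu)%N).
Hypothesis eps_unit : forall j, (j < m)%N -> (eps j 0%N : nat) != 0%N.
Local Notation r := (m + 2 * s)%N.
Local Notation n := (r.-1).
Let p_gt0 := prime_gt0 p_pr.
Let p_gt1 := prime_gt1 p_pr.
Local Notation sigma := (@block_index m s m_ge2).
Local Notation i0 := (special s m_ge2).
Local Notation vec := (Mat m s -> padicInt p).
Local Notation fcoef := (fcoef m eps).
Local Notation funit := (funit m nu eps s).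
Local Notation fmx := (fmx m_ge2).

(** If W G = 0 mod p^N, unimodularity of S kills every coordinate of W except the special one, and
    that one is annihilated by p^nu. Row 0 of g differs from the unit row by multiples of p^nu, so W
    g = W. *)
Lemma identity_isometry_disc_trivial (g : vec) :
  identity_component m_ge2 g -> Defs.isometry nu eps g -> disc_trivial nu eps g.
Proof.
move=> g1 giso N w H i.
have [N0|N0] := posnP N; first by rewrite N0 congE expn0 dvd1z.
have bij := block_index_bij s m_ge2; have [s' sK s'K] := bij.
pose W : 'rV['Z_(p ^ N)]_(1 + n) := \row_a (trunc (w (sigma a)) N)%:~R.
have WG : W *m fform m nu eps s N = 0.
  rewrite -(fform_level nu eps s p_pr m_ge2 N0 (leqnn N)); apply/rowP => b.
  have := H (sigma b); rewrite cong_intr // => /eqP; rewrite mulr0z => Hb.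
  rewrite [RHS]mxE -[RHS]Hb BvalE mxE rmorph_sum (reindex sigma) /=; last exact: onW_bij.
  apply: eq_bigr => a _; rewrite gramE !mxE -rmorphM (bigD1 (sigma b)) //= big1 ?addr0.
    by rewrite /basisv eqxx mulr1.
  by move=> l lb; rewrite /basisv eq_sym (negbTE lb) mulr0.
have [w0 w1] : p%:R ^+ nu * lsubmx W 0 0 = 0 /\ rsubmx W = 0.
  move: WG; rewrite -{1}[W]hsubmxK mul_row_block !mulmx0 addr0 add0r.
  rewrite -[X in _ = X]row_mx0 => /eq_row_mx[/matrixP/(_ 0 0) h0 h1]; split.
    move: h0; rewrite mul_mx_scalar !mxE mulrAC mulrC => /eqP.
    by rewrite -[X in _ == X](mulr0 (fcoef N)) (inj_eq (mulrI _)) ?(fcoef_unit p_pr p_odd m_ge2 eps_unit) // => /eqP.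
  by rewrite -[rsubmx W](mulmxK (funit_unit nu s p_pr p_odd m_ge2 eps_unit N0)) h1 mul0mx.
have ord00 : lshift n (0 : 'I_1) = 0 :> 'I_(1 + n) by apply: val_inj.
rewrite mxE ord00 in w0.
have W1 j : W 0 (rshift 1 j) = 0 by have /rowP/(_ j) := w1; rewrite !mxE.
have [[y yE] z] := isometry_special_row p_pr p_odd nu_gt0 eps_unit N0 g1 giso.
have WM : W *m fmx N N g = W.
  apply/rowP => b; rewrite mxE big_split_ord /= big_ord1 ord00 [X in _ + X]big1 ?addr0; last first.
    by move=> j _; rewrite W1 mul0r.
  case: (split_ordP b) => b' ->; last first.
    by have [t ->] := z b'; rewrite W1 mulrA [_ * p%:R ^+ nu]mulrC w0 mul0r.
  rewrite ord1 ord00 -[fmx N N g 0 0](subrK 1) yE mulrDr mulr1.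
  by rewrite mulrA [_ * p%:R ^+ nu]mulrC w0 mul0r add0r.
rewrite cong_intr // mulr0z rmorphB rmorph_sum /= subr_eq0 (reindex sigma) /=; last exact: onW_bij.
move/rowP/(_ (s' i)): WM; rewrite !mxE s'K => <-; apply/eqP.
by apply: eq_bigr => a _; rewrite !mxE s'K rmorphM mulrC.
Qed.

Lemma SOprimeE :
  SOprime p m nu eps s = identity_component m_ge2 `&` \bigcap_k near_fibre nu eps k.
Proof.
rewrite eqEsubset; split=> g.
  by move=> gS; split; [exact: SOprime_identity_component gS|move=> k _; case: gS].
case=> g1 gN; have giso : Defs.isometry nu eps g by move=> k; exact: gN.
split=> //; split; first exact: identity_isometry_det_one giso.
exact: identity_isometry_disc_trivial.
Qed.

(** A cluster point of points outside U at growing levels satisfies every congruence, hence lies in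
    SO' and in U; a ball around it inside U would contain one of those points. *)
Lemma near_identity_sub_open (U : set vec) : popen U -> SOprime p m nu eps s `<=` U ->
  exists K, forall k, (K <= k)%N ->
    identity_component m_ge2 `&` near_fibre nu eps k `<=` U.
Proof.
move=> Uo SU; apply: contrapT => /forallNP nK.
have /choice[u uE] : forall K, exists g, exists2 k, (K <= k)%N &
    (identity_component m_ge2 g /\ near_fibre nu eps k g) /\ ~ U g.
  move=> K; apply: contrapT => /forallNP nu'; apply: (nK K) => k Kk g gk.
  by apply: contrapT => nUg; apply: (nu' g); exists k.
have [x xE] := padic_cluster u.
have level j (j0 : (0 < j)%N) : identity_component m_ge2 x /\ near_fibre nu eps j x.
  have [N jN xN] := xE j j; have [k Nk [[u1 uk] _]] := uE N.
  have uj : (identity_component m_ge2 `&` near_fibre nu eps j) (u N).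
    by split=> //; apply: near_fibre_le uk => //; exact: leq_trans Nk.
  move: uj; rewrite (near_identity_level nu eps s p_pr p_odd m_ge2 j0) /level_set /=.
  move/(@residues_eqP p _ p_gt1) : xN => ->.
  by rewrite -[is_true _]/(level_set p_gt1 _ _) -near_identity_level.
have Sx : SOprime p m nu eps s x.
  rewrite SOprimeE; split; first by have [] := level 1%N isT.
  move=> k _; have [_] := level k.+1 isT; exact: near_fibre_le.
have [k kU] := Uo x (SU x Sx); have [N _ xN] := xE k 0%N.
by have [? _ [_]] := uE N; apply; apply: kU.
Qed.

Lemma identity_component_open : popen (identity_component m_ge2 : set vec).
Proof.
move=> g g1; exists 1%N => h hg; rewrite /identity_component /=.
have tE ij : trunc (h ij) 1 = trunc (g ij) 1.
  by rewrite !truncE; congr Posz; apply: residue_ext => t; apply: hg.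
have -> : row_mx_of h 1 = row_mx_of g 1 by apply/matrixP => a b; rewrite !mxE tE.
by rewrite tE.
Qed.

End FibreNeighbourhoods.

(** * The volume *)

Lemma limn_esup_ge (R : realType) (u : nat -> \bar R) (v : \bar R) :
  (\forall k \near \oo, (v <= u k)%E) -> (v <= limn_esup u)%E.
Proof.
move=> uv; apply/ereal_infP => _ [V oV <-].
have [k [uk Vk]] := filter_ex (filterI uv oV).
by apply: le_trans uk _; apply: ereal_sup_ubound; exists k.
Qed.

Lemma pabs_val (R : realType) (p nu : nat) (c : nat -> int) : (1 < p)%N ->
  (forall n, cong p n (c n) 0 = (n <= nu)%N) -> pabs R p c = p%:R ^- nu.
Proof.
move=> p1 cnu; have p0 : 0 < p%:R :> R by rewrite ltr0n ltnW.
have lb : lbound [set (p%:R ^- n : R) | n in [set n : nat | cong p n (c n) 0]] (p%:R ^- nu).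
  move=> _ [n /= nc <-]; rewrite lef_pV2 ?posrE ?exprn_gt0 //.
  by apply: ler_weXn2l; [rewrite ler1n ltnW|rewrite -cnu].
have mem : [set (p%:R ^- n : R) | n in [set n : nat | cong p n (c n) 0]] (p%:R ^- nu).
  by exists nu => //=; rewrite cnu.
apply/eqP; rewrite eq_le; apply/andP; split; last by apply: lb_le_inf => //; exists (p%:R ^- nu).
by apply: ge_inf => //; exists (p%:R ^- nu).
Qed.

Lemma legendre_chi (p : nat) (a : int) : prime p -> legendre p a = chi (a%:~R : 'F_p).
Proof.
move=> p_pr; rewrite /legendre /chi Fp_intr_eq0 //; case: ifP => // _.
congr (if _ then _ else _); apply/existsP/existsP => -[x].
  rewrite cong_Fp // => /eqP xa; exists (x : nat)%:R; rewrite -xa.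
  by rewrite rmorphXn.
move=> /eqP xa; have xp : (x < p)%N by rewrite -[X in (_ < X)%N](Fp_cast p_pr).
exists (Ordinal xp); rewrite cong_Fp // -xa rmorphXn /=; apply/eqP; congr (_ ^+ 2).
exact: natr_Zp.
Qed.

Section Volume.
Variables (R : realType) (p m nu : nat) (eps : nat -> padicInt p) (s : nat).
Hypotheses (p_pr : prime p) (p_odd : p != 2%N) (m_ge2 : (2 <= m)%N) (nu_gt0 : (0 < nu)%N).
Hypothesis eps_unit : forall j, (j < m)%N -> (eps j 0%N : nat) != 0%N.
Local Notation r := (m + 2 * s)%N.
Local Notation n := (r.-1).
Let p_gt0 := prime_gt0 p_pr.
Let p_gt1 := prime_gt1 p_pr.

Lemma card_QIdx : #|{: QIdx m s}| = 'C(r.+1, 2).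
Proof. exact: card_upper. Qed.

Lemma card_Mat : #|{: Mat m s}| = (r * r)%N.
Proof. by rewrite card_prod card_ord. Qed.

Lemma pabs_nu : pabs R p (fun=> (p ^ nu)%N%:Z) = p%:R ^- nu.
Proof.
by apply: pabs_val => // k; rewrite congE subr0 dvdzE /= dvdn_Pexp2l.
Qed.

Lemma pabs_det_gram : pabs R p (fun k => \det (gram m nu eps s k)) = p%:R ^- nu.
Proof.
apply: pabs_val => // k; rewrite congE subr0 det_gram //.
have [->|k0] := posnP k; first by rewrite expn0 dvd1z.
set u := \det _; set t := trunc _ _.
have -> : 2 * ((p ^ nu)%N%:Z * t) * u = (p ^ nu)%N%:Z * (2 * t * u) by ring.
rewrite Gauss_dvdzl ?dvdzE /= ?dvdn_Pexp2l // coprimezE /= coprimeXl //.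
rewrite prime_coprime // -[(p %| _)%N]/((p%:Z %| 2 * t * u)%Z) -Fp_intr_eq0 //.
rewrite !rmorphM !mulf_neq0 ?Fp_two_neq0 ?unit_part_Fp //.
by apply: (trunc_eps_neq0 p_pr eps_unit) => //; rewrite ltn_predL (ltnW m_ge2).
Qed.

Local Notation dens := (so_density R n ((\det (unit_mx m nu eps s 1))%:~R : 'F_p)).

Lemma haar_Qbox k : fine (haar R (@Qbox p m nu eps s k)) = p%:R ^- (k * 'C(r.+1, 2))%N.
Proof.
have Q0 : (0 < #|{: QIdx m s}|)%N by rewrite card_QIdx bin_gt0; lia.
pose c (jl : QIdx m s) := (qcoef p m nu eps s k (val jl).1 (val jl).2 %% (p ^ k)%N%:Z)%Z.
have pk0 : (p ^ k)%N%:Z != 0 by rewrite eqz_nat -lt0n expn_gt0 p_gt0.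
have c_ge0 jl : 0 <= c jl by rewrite modz_ge0.
have c_lt jl : (`|c jl| < p ^ k)%N.
  by rewrite -ltz_nat gez0_abs // ltz_pmod // ltz_nat expn_gt0 p_gt0.
have -> : @Qbox p m nu eps s k = level_set p_gt1 (pred1 [ffun jl => Ordinal (c_lt jl)]).
  have resP jl (x : padicInt p) : cong p k (trunc x k) (qcoef p m nu eps s k (val jl).1 (val jl).2) <->
      residue x k = `|c jl|%N.
    have cE : (qcoef p m nu eps s k (val jl).1 (val jl).2 %% (p ^ k)%N%:Z)%Z = `|c jl|%N%:Z.
      by rewrite gez0_abs.
    by rewrite /cong truncE modz_nat cE modn_small ?(residue_lt p_gt0) //; split=> [/eqP[]|->].
  rewrite eqEsubset; split=> x; rewrite /level_set /Qbox /=.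
    by move=> xQ; apply/eqP/ffunP => jl; rewrite !ffunE; apply: val_inj => /=; apply/resP.
  by move=> /eqP/ffunP xq jl; apply/resP; have := xq jl; rewrite !ffunE => -[].
by rewrite fine_haar_level // card1 mul1r card_QIdx.
Qed.

Lemma near_volume k : (nu < k)%N ->
  fine (haar R ((identity_component m_ge2 : set (Mat m s -> padicInt p)) `&` near_fibre nu eps k))
    / mu2_box m nu eps s R k =
  p%:R ^+ nu * dens / (p%:R ^- nu) `^ (- ((r.+1)%:R / 2)).
Proof.
move=> nk; have k0 : (0 < k)%N by exact: leq_ltn_trans nk.
have I0 : (0 < #|{: Mat m s}|)%N by rewrite card_Mat muln_gt0; lia.
have n0 : (0 < n)%N by lia.
rewrite (near_identity_level nu eps s p_pr p_odd m_ge2 k0) fine_haar_level //.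
rewrite card_isometry_residues card_Mat /mu2_box pabs_det_gram haar_Qbox.
have := degenerate_density R p_pr p_odd k0 nu_gt0 nk n0 (fcoef_unit p_pr p_odd m_ge2 eps_unit k0)
   (funit_sym m nu eps s k) (funit_unit nu s p_pr p_odd m_ge2 eps_unit k0).
rewrite (rank_predK s m_ge2).
have -> : \det (map_mx (Zpk_reduction p_pr k0) (funit m nu eps s k)) =
   (\det (unit_mx m nu eps s 1))%:~R.
  rewrite det_map_mx /funit det_map_mx rmorph_int !det_unit_part //.
  rewrite !rmorphM !rmorph_prod; congr (_ * _); apply: eq_bigr => j _.
  by rewrite !rmorphM /= !(trunc_Fp p_pr).
by move=> <-; rewrite invfM; ring.
Qed.

(** For the upper bound the open set [identity_component] itself is admissible, and its quotients
    are constant for k > nu. For the lower bound every admissible U contains the same neighbourhoods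
    for large k. *)
Lemma fibre_vol_SOprime :
  fibre_vol p m nu eps s R (SOprime p m nu eps s) =
  (p%:R ^+ nu * dens / (p%:R ^- nu) `^ (- ((r.+1)%:R / 2)))%:E.
Proof.
set V := (X in _ = X%:E).
have mu2_gt0 k : 0 < mu2_box m nu eps s R k.
  rewrite /mu2_box pabs_det_gram haar_Qbox mulr_gt0 ?invr_gt0 ?exprn_gt0 ?ltr0n //.
  by rewrite powR_gt0 // invr_gt0 exprn_gt0 ?ltr0n.
apply/eqP; rewrite eq_le; apply/andP; split.
  apply: ge_ereal_inf.
  exists (limn_esup (fun k => (fine (haar R ((identity_component m_ge2 : set (Mat m s -> padicInt p))
      `&` near_fibre nu eps k)) / mu2_box m nu eps s R k)%:E)).
    exists (identity_component m_ge2) => //; split; first exact: identity_component_open.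
    exact: SOprime_identity_component.
  set u := (X in limn_esup X).
  have uV : u @ \oo --> V%:E.
    by apply: cvg_near_cst; exists nu.+1 => // k /= nk; rewrite /u near_volume.
  by rewrite (cvg_limn_einf_sup uV).2.
apply/ereal_infP => _ [U [Uo SU] <-].
have [K KU] := near_identity_sub_open p_pr p_odd m_ge2 nu_gt0 eps_unit Uo SU.
apply: limn_esup_ge; exists (maxn K nu.+1) => // k /=; rewrite geq_max => /andP[Kk nk].
rewrite lee_fin /V -(near_volume nk) ler_pM2r ?invr_gt0 //.
have I0 : (0 < #|{: Mat m s}|)%N by rewrite card_Mat muln_gt0; lia.
apply: le_fine_haar => // g gk; split; first exact: KU gk.
by case: gk.
Qed.

(** The first s factors are the normalisation of [lambda_p]; the others are shifted by s. For odd m,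
    n is even and the discriminant of S is (-1)^s 2^(m-1) times the product of the eps_j: the sign
    (-1)^s cancels against the one in (-1)^(n/2), and 2^(m-1) is a square. *)
Lemma so_density_unit_part : dens =
  \prod_(1 <= i < s.+1) (1 - p%:R ^- (2 * i)) *
  (\prod_(1 <= i < m./2) (1 - p%:R ^- (2 * i + 2 * s)%N) *
   (if odd m then
      1 - (legendre p ((-1) ^+ (m.-1)./2 * \prod_(j < m.-1) trunc (eps j) 1))%:~R
            * p%:R ^- ((m.-1)./2 + s)%N
    else 1)) :> R.
Proof.
have half_n : uphalf n = (m./2 + s)%N by lia.
rewrite /so_density card_Fp // half_n mulrA; congr (_ * _).
  rewrite (big_cat_nat (n := s.+1)) //=; last by lia.
  congr (_ * _); rewrite -[s.+1]addn1 addnC big_addn.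
  rewrite (_ : (m./2 + s - s = m./2)%N); last by rewrite addnK.
  by apply: eq_bigr => i _; rewrite mulnDr.
have -> : odd n = ~~ odd m by lia.
case: (boolP (odd m)) => //= om.
have half_n' : n./2 = ((m.-1)./2 + s)%N by lia.
rewrite half_n'; congr (1 - _ * _); rewrite /disc_sign legendre_chi // half_n'; congr (_%:~R).
rewrite -[RHS](@chi_sqrM _ (2%:R ^+ (m.-1)./2)) ?expf_neq0 ?Fp_two_neq0 //; congr (chi _).
rewrite det_unit_part // !rmorphM !rmorphXn !rmorph_prod rmorphN1 /=.
under eq_bigr do rewrite rmorphM.
rewrite big_split /= prodr_const card_ord.
have m2 : (m.-1 = (m.-1)./2 * 2)%N by lia.
have -> : 2%:~R ^+ m.-1 = (2%:~R ^+ (m.-1)./2) ^+ 2 :> 'F_p by rewrite -exprM -m2.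
rewrite exprD.
set P := \prod_(i < _) _; set t := 2%:~R ^+ _.
have -> : (-1) ^+ (m.-1)./2 * (-1) ^+ s * ((-1) ^+ s * (t ^+ 2 * P)) =
   ((-1) ^+ s * (-1) ^+ s) * (t ^+ 2 * ((-1) ^+ (m.-1)./2 * P)) by ring.
by rewrite -expr2 sqrr_sign mul1r.
Qed.

End Volume.

Theorem mainTheorem10 (R : realType) (p m nu : nat) (eps : nat -> padicInt p) (s : nat)
  (hp : prime p) (hp2 : p != 2%N) (hm : (2 <= m)%N) (hnu : (1 <= nu)%N)
  (heps : forall j, (j < m)%N -> (eps j 0 : nat) != 0%N) :
  lambda_p R p m nu eps s =
  (pabs R p (fun _ => ((p ^ nu)%N)%:Z) `^ (s%:R + (m%:R - 1) / 2)
   * (\prod_(1 <= i < m./2) (1 - p%:R ^- (2 * i + 2 * s)%N))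
   * (if odd m then
        1 - (legendre p ((-1) ^+ (m.-1)./2 * \prod_(j < m.-1) trunc (eps j) 1))%:~R
              * p%:R ^- ((m.-1)./2 + s)%N
      else 1))%:E.
Proof.
rewrite /lambda_p fibre_vol_SOprime // so_density_unit_part // pabs_nu // -EFinM.
congr (_%:E); set P := \prod_(1 <= i < s.+1) _; set X := \prod_(1 <= i < m./2) _.
set Y := (if _ then _ else _).
have p1 : 1 < p%:R :> R by rewrite ltr1n prime_gt1.
have P0 : P != 0.
  rewrite /P prodf_seq_neq0; apply/allP => i; rewrite mem_index_iota /= => /andP[i0 _].
  by rewrite subr_eq0 eq_sym invr_eq1 gt_eqF // exprn_egt1 // muln_eq0 -lt0n i0.
have q0 : 0 < p%:R ^- nu :> R by rewrite invr_gt0 exprn_gt0 // (lt_trans ltr01).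
set q : R := p%:R ^- nu in q0 *.
have -> : p%:R ^+ nu = q^-1 by rewrite /q invrK.
set a := _.+1%:R / 2.
(* The summand -1 accounts for the torsion factor p^nu, and a = (r + 1) / 2 for the normalisation of
   mu_2. *)
have -> : s%:R + (m%:R - 1) / 2 = -1 + a :> R.
  by rewrite /a -[(m + 2 * s).+1%:R]natr1 natrD natrM; field.
have qn0 : q != 0 by rewrite gt_eqF.
rewrite powRD ?qn0 ?implybT // powR_inv1 ?ltW // (powRN q a) invrK.
by field; rewrite qn0 P0.
Qed.
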